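(* For a $V$-elliptic Lax--Milgram operator $A$ with $\sigma(A)\ne\emptyset$ there is a strictly descending chain of dense domains $D(e^{tA})$ of the inverses $e^{tA}=(e^{-tA})^{-1}$, i.e. $$D(e^{t'A})\subsetneq D(e^{tA})\subsetneq H\qquad\text{for }t'>t>0,$$ each $D(e^{tA})$ being dense in $H$.
   Context: $V$ and $H$ are separable complex Hilbert spaces, $V\subseteq H$ algebraically, topologically and densely, and $V^*$ is the antidual of $V$ (conjugate-linear functionals), so $V\subseteq H\equiv H^*\subseteq V^*$; $\|\cdot\|$ is the norm on $V$, and $\langle\cdot,\cdot\rangle$ is the sesquilinear duality on $V^*\times V$ extending the inner product of $H$ on $H\times V$. The sesquilinear form $a$ on $V$ is bounded and $V$-elliptic: there are $C_3,C_4>0$ with $|a(u,v)|\le C_3\|u\|\|v\|$ and $\operatorname{Re}a(v,v)\ge C_4\|v\|^2$ for all $u,v\in V$. $\mathcal{A}\colon V\to V^*$ is given by $\langle\mathcal{A}u,v\rangle=a(u,v)$; the ($V$-elliptic) Lax--Milgram operator $A$ in $H$ is $Au=\mathcal{A}u$ with $D(A)=\{u\in V\mid\mathcal{A}u\in H\}$. It is known that $-A$ generates an analytic semigroup $e^{-tA}$ on $H$ and that each $e^{-tA}$, $t\ge0$, is injective; $e^{tA}:=(e^{-tA})^{-1}$ is its inverse with domain $D(e^{tA})=R(e^{-tA})$. $\sigma(A)$ is the spectrum of $A$ in $H$.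
   Formalization: V is additionally assumed to be a proper subspace of H (V ≠ H); if V = H, e.g. V = H = ℂ with a(u,v) = u v̄, then A is bounded, every D(e^{tA}) equals H, and the strict inclusions fail. *)

(* Defs.v *)
(* The complex field is [R[i]] for an arbitrary [R : realType]. *)
From HB Require Import structures.
From mathcomp Require Import all_boot all_order all_algebra.
From mathcomp Require Import sesquilinear complex ring.
From mathcomp Require Import all_classical all_reals all_analysis.
Set Implicit Arguments.
Unset Strict Implicit.
Unset Printing Implicit Defensive.
Import Order.TTheory GRing.Theory Num.Theory Num.Def.
Import numFieldNormedType.Exports.
Local Open Scope classical_set_scope.
Local Open Scope ring_scope.
Local Open Scope complex_scope.

Section Hilbert.
Variable R : realType.

(* With [H] complete, this makes [(H, ip)] a complex Hilbert space; as in
   [sesquilinear], [ip] is linear in its first argument. *)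
Definition norm_from_inner (H : normedModType R[i]) (ip : {dot H for conjC}) :=
  forall x : H, `|x| ^+ 2 = ip x x.

Definition separable (T : topologicalType) :=
  exists2 D : set T, countable D & dense D.

End Hilbert.

Section UnboundedOperators.
Variables (R : realType) (H : normedModType R[i]).

(* A partially defined operator is given by its graph: [G (x, y)] means that
   [x] is in the domain and [y] is the value at [x]. *)
Implicit Types G : set (H * H).

Definition op_domain G : set H := [set x | exists y, G (x, y)].

Definition op_opp G : set (H * H) := [set p | G (p.1, - p.2)].

Definition op_inverse G : set (H * H) := [set p | G (p.2, p.1)].

Definition op_of_fun (f : H -> H) : set (H * H) := [set p | f p.1 = p.2].

(* The graph of [lambda I - G]. *)
Definition op_shift (lambda : R[i]) G : set (H * H) :=
  [set p | G (p.1, lambda *: p.1 - p.2)].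

(* [lambda I - G : D(G) -> H] is bijective with bounded inverse. *)
Definition resolvent_set G : set R[i] :=
  [set lambda |
    (forall y, exists! x, op_shift lambda G (x, y)) /\
    (exists M : R, forall x y, op_shift lambda G (x, y) ->
        `|x| <= M%:C * `|y|)].

Definition spectrum G : set R[i] := ~` resolvent_set G.

(* Only the values of [S] at [t >= 0] are meaningful. *)
Definition C0_semigroup (S : R -> {linear H -> H}) :=
  [/\ forall t, 0 <= t -> continuous (S t),
      forall x, S 0 x = x,
      forall s t, 0 <= s -> 0 <= t -> forall x, S (s + t) x = S s (S t x)
    & forall x, S t x @[t --> 0^'+] --> x].

Definition generator (S : R -> {linear H -> H}) : set (H * H) :=
  [set p | (h%:C)^-1 *: (S h p.1 - p.1) @[h --> 0^'+] --> p.2].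

Definition generates G (S : R -> {linear H -> H}) :=
  C0_semigroup S /\ generator S = G.

End UnboundedOperators.

Section Antidual.
Variables (R : realType) (V : normedModType R[i]).

Definition antidual : set (V -> R[i]) :=
  [set f | linear_for (conjC \; *%R) f /\ continuous f].

Lemma linear_bounded_antidual (f : V -> R[i]) (M : R[i]) :
  linear_for (conjC \; *%R) f -> (forall v, `|f v| <= M * `|v|) -> antidual f.
Proof.
move=> flin fM; split=> // v; apply/cvgrPdist_lt => e e0.
have M1 : 0 < `|M| + 1 by rewrite ltr_wpDl.
near=> w.
have -> : f v - f w = f (v - w).
  have fB : f (v - w) = f v - f w.
    by rewrite addrC -scaleN1r flin /= rmorphN1 mulN1r addrC.
  by rewrite fB.
apply: (@le_lt_trans _ _ ((`|M| + 1) * `|v - w|)).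
  have h := fM (v - w).
  have h0 : 0 <= M * `|v - w| by exact: le_trans h.
  rewrite (le_trans h)// -[leLHS]ger0_norm// normrM normr_id.
  by rewrite ler_wpM2r// lerDl.
rewrite mulrC -ltr_pdivlMr//; near: w.
by apply: (@cvgr_dist_lt _ _ _ _ _ id); [exact: cvg_id|rewrite divr_gt0].
Unshelve. all: by end_near. Qed.

End Antidual.

Section LaxMilgram.
Variables (R : realType) (V H : normedModType R[i]).
Variables (ip : {dot H for conjC}) (emb : {linear V -> H}).
Variable a : {bilinear V -> V -> R[i] | *%R & conjC \; *%R}.

(* [emb] is the inclusion of [V] in [H]. *)
Definition dense_embedding :=
  [/\ injective emb, continuous emb & dense (range emb)].

(* The identification of [h : H] with an element of the antidual of [V]. *)
Definition H_in_antidual (h : H) : V -> R[i] := fun v => ip h (emb v).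

Definition bounded_form :=
  exists2 C3 : R, 0 < C3 & forall u v, `|a u v| <= C3%:C * `|u| * `|v|.

Definition elliptic_form :=
  exists2 C4 : R, 0 < C4 & forall v, C4%:C * `|v| ^+ 2 <= 'Re (a v v).

(* Written with a script A in the literature: the operator from [V] to its
   antidual defined by [a]. *)
Definition form_operator (u : V) : V -> R[i] := fun v => a u v.

(* The part of [form_operator] in [H]. *)
Definition lax_milgram : set (H * H) :=
  [set p | exists2 u, emb u = p.1 & form_operator u = H_in_antidual p.2].

Lemma form_operator_antidual : bounded_form ->
  forall u, antidual (form_operator u).
Proof.
move=> [C3 _ aC] u; apply: (@linear_bounded_antidual _ _ _ (C3%:C * `|u|)).
  by move=> c v w; exact: linearPr.
by move=> v; exact: aC.
Qed.

Lemma H_in_antidual_antidual : norm_from_inner ip -> dense_embedding ->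
  forall h, antidual (H_in_antidual h).
Proof.
move=> ipN [_ embC _] h; split.
  by move=> c v w; rewrite /H_in_antidual linearP; exact: linearPr.
have [_ ipC] : antidual (fun w => ip h w).
  apply: (@linear_bounded_antidual _ _ _ `|h|).
    by move=> c v w; exact: linearPr.
  move=> w; rewrite -ler_sqr ?nnegrE ?mulr_ge0 // exprMn !ipN.
  have [->|w0] := eqVneq w 0.
    by rewrite linear0r linear0l normr0 expr0n mulr0.
  have ww : 0 < ip w w by rewrite -ipN exprn_gt0 ?normr_gt0.
  have ipJ x y : ip x y = conjC (ip y x).
    by rewrite hermC expr0 mul1r.
  set c := ip h w / ip w w.
  have : 0 <= ip (h - c *: w) (h - c *: w) by rewrite -ipN exprn_ge0.
  have -> : ip (h - c *: w) (h - c *: w) = ip h h - `|ip h w| ^+ 2 / ip w w.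
    rewrite linearBl (linearBr ip h) (linearBr ip (c *: w)).
    rewrite !(linearZl_LR ip) !(linearZr_LR ip) /= normCK.
    have -> : conjC c = ip w h / ip w w.
      by rewrite /c rmorphM /= fmorphV /= -ipJ -ipJ.
    rewrite -(ipJ w h) /c; field.
    by rewrite gt_eqF.
  by rewrite subr_ge0 ler_pdivrMr.
by move=> v; exact: continuous_comp (embC v) (ipC (emb v)).
Qed.

End LaxMilgram.

(* Main.v *)
(* Write S(t) = e^{-tA}.  Ellipticity makes S contractive, and a Lyapunov
   function gives the smoothing estimate |A S(t) x| <= (M / t) |x|; both use the
   density of D(A^2), a consequence of the Lax-Milgram lemma.  Smoothing makes
   every scalar orbit g(s) = Re <S(s) x, y> analytic on (0, oo), in the sense
   that the n-th Taylor remainder is at most (C (t0 - s) / s)^n.  Hence if g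
   vanishes on [t0, oo) it vanishes on (0, oo), and Re <x, y> = 0.  This gives
   the injectivity of S(t) (take S(t) x = 0) and the density of its range (take
   y orthogonal to it).  Finally S(t') = S(t) S(t' - t), and if S(t) and S(t')
   had the same range then S(t' - t) would be onto by injectivity, whereas its
   range lies in D(A), inside V, a proper subspace of H. *)
Require Import Defs.
From HB Require Import structures.
From mathcomp Require Import all_boot all_order all_algebra.
From mathcomp Require Import sesquilinear complex ring lra.
From mathcomp Require Import all_classical all_reals all_analysis.
Set Implicit Arguments.
Unset Strict Implicit.
Unset Printing Implicit Defensive.
Import Order.TTheory GRing.Theory Num.Theory Num.Def.
Import numFieldNormedType.Exports.
Local Open Scope classical_set_scope.
Local Open Scope ring_scope.
Local Open Scope complex_scope.

(** The hypothesis [generates] supplies only a strongly continuous semigroup of individually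
    continuous operators: no norm bound, no holomorphy. Local boundedness therefore comes from the
    uniform boundedness principle, and analyticity is replaced by quantitative real-variable
    estimates. The smoothing constant is M = C3 / (2 C4), the value for which the derivative of the
    Lyapunov function is at most -2 C4 times a square. One smoothing costs a waiting time r and a
    factor M / r; n of them with r = s / (n + 1) fit below s and cost (M (n + 1) / s)^n, which the
    n! of the Taylor remainder compensates because (n + 1)^n / n! <= 4^(n + 1). Vanishing on [t0,
    oo) thus extends to every s in (0, t0] with 4 M (t0 - s) < s, in particular down to q t0 for a
    fixed q < 1, and iteration reaches every s > 0. *)

Notation "r *:: x" := (r%:C *: x) (at level 40).

Lemma ltr0c (R : realType) (r : R) : ((0 : R[i]) < r%:C) = (0 < r).
Proof. exact: ltcR. Qed.

Lemma cvg_dist_le (R : realType) (T : Type) (F : set_system T) (FF : Filter F)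
    (f g : T -> R) (l : R) :
  (\forall t \near F, `|f t - l| <= g t) -> g @ F --> (0 : R) -> f @ F --> l.
Proof.
move=> fg /cvgrPdist_lt g0; apply/cvgrPdist_lt => e e0.
apply: filterS2 fg (g0 e e0) => t ft gt; rewrite distrC (le_lt_trans ft)//.
by move: gt; rewrite sub0r normrN; apply: le_lt_trans; exact: ler_norm.
Qed.

(** * Real parts of the norm and of the inner product *)

Section RealNorm.
Variables (R : realType) (V : normedModType R[i]).
Implicit Types (x y : V) (r : R).

(** The norm of a space over [R[i]] takes its values in [R[i]]; its real part carries the total
    order and the limits of [R]. *)
Definition rnorm x : R := complex.Re `|x|.

Lemma normE x : `|x| = (rnorm x)%:C.
Proof. by rewrite /rnorm RRe_real// ger0_real. Qed.

Lemma rnorm_ge0 x : 0 <= rnorm x.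
Proof. by rewrite -ler0c -normE. Qed.

Lemma rnormN x : rnorm (- x) = rnorm x.
Proof. by rewrite /rnorm normrN. Qed.

Lemma rnormB x y : rnorm (x - y) = rnorm (y - x).
Proof. by rewrite /rnorm distrC. Qed.

Lemma ler_rnormD x y : rnorm (x + y) <= rnorm x + rnorm y.
Proof. by rewrite -lecR rmorphD /= -!normE ler_normD. Qed.

Lemma rnorm_triangle z x y : rnorm (x - y) <= rnorm (x - z) + rnorm (z - y).
Proof. by rewrite (le_trans _ (ler_rnormD _ _))// addrA subrK. Qed.

Lemma rnormZ r x : rnorm (r *:: x) = `|r| * rnorm x.
Proof.
apply: complexI; rewrite rmorphM /= -!normE normrZ; congr (_ * _).
by rewrite normc_def /= expr0n addr0 sqrtr_sqr.
Qed.

Lemma rnorm0 : rnorm (0 : V) = 0.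
Proof. by rewrite /rnorm normr0. Qed.

Lemma rnorm_eq0 x : rnorm x = 0 -> x = 0.
Proof. by move=> x0; apply/eqP; rewrite -normr_eq0 normE x0. Qed.

Lemma rscale1 x : 1 *:: x = x.
Proof. exact: scale1r. Qed.

Lemma rscaleN r x : (- r) *:: x = - (r *:: x).
Proof. by rewrite rmorphN scaleNr. Qed.

Lemma rnorm_ball x (e : R) : 0 < e -> nbhs x [set y | rnorm (y - x) < e].
Proof.
move=> e0; apply/nbhs_ballP; exists e%:C; first by rewrite /= ltr0c.
by move=> y; rewrite -ball_normE /ball_ /= normE ltcR rnormB.
Qed.

Lemma nbhs_rnorm x (A : set V) : nbhs x A ->
  exists2 e : R, 0 < e & forall y, rnorm (y - x) < e -> A y.
Proof.
move=> /nbhs_ballP [e /= e0 eA].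
have eR : e = (complex.Re e)%:C by rewrite RRe_real// gtr0_real.
exists (complex.Re e); first by rewrite -ltr0c -eR.
move=> y yx; apply: eA; rewrite -ball_normE /ball_ /=.
by rewrite normE eR ltcR rnormB.
Qed.

Lemma cvg_rnormP (T : Type) (F : set_system T) (FF : Filter F) (f : T -> V) x :
  f @ F --> x <-> rnorm (f t - x) @[t --> F] --> (0 : R).
Proof.
split=> [fx|fx].
- apply/cvgrPdist_lt => e e0.
  have : \forall t \near F, rnorm (f t - x) < e by exact: fx (rnorm_ball x e0).
  apply: filterS => t /=; by rewrite sub0r normrN ger0_norm ?rnorm_ge0.
- move=> A /nbhs_rnorm [e e0 eA].
  move/cvgrPdist_lt : fx => /(_ e e0).
  by apply: filterS => t /=; rewrite sub0r normrN ger0_norm ?rnorm_ge0//; exact: eA.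
Qed.

Lemma dense_rnormP (A : set V) :
  dense A <-> forall x (e : R), 0 < e -> exists2 y, A y & rnorm (y - x) < e.
Proof.
split=> [dA x e e0|dA B [x Bx] Bo].
- have [y [/= yx Ay]] : (ball x e%:C) `&` A !=set0.
    apply: dA; last by apply: ball_open; rewrite ltr0c.
    by exists x; apply: ballxx; rewrite ltr0c.
  exists y => //; move: yx; rewrite -ball_normE /ball_ /=.
  by rewrite normE ltcR rnormB.
- have [e e0 eB] := nbhs_rnorm (open_nbhs_nbhs (conj Bo Bx)).
  by have [y Ay yx] := dA x e e0; exists y; split => //; exact: eB.
Qed.

End RealNorm.

Lemma rnorm_complete (R : realType) (V : completeNormedModType R[i])
    (u : nat -> V) :
  (forall e : R, 0 < e -> exists n0, forall m n, (n0 <= m)%N -> (n0 <= n)%N ->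
     rnorm (u m - u n) < e) ->
  exists x, rnorm (u n - x) @[n --> \oo] --> (0 : R).
Proof.
move=> uC; suff : cvg (u @ \oo).
  by move=> /cvg_ex[x ux]; exists x; apply/cvg_rnormP.
apply: cauchy_cvg; apply/cauchy_ballP => e e0.
have eR : e = (complex.Re e)%:C by rewrite RRe_real// gtr0_real.
have [|n0 un0] := uC (complex.Re e); first by rewrite -ltr0c -eR.
exists (u @` [set n | (n0 <= n)%N], u @` [set n | (n0 <= n)%N]).
  by split; exists n0 => // n /= n0n; exists n.
move=> _ [/= [m /= mn0 <-] [n /= nn0 <-]]; rewrite -ball_normE /ball_ /=.
by rewrite normE eR ltcR un0.
Qed.

Section RealInner.
Variables (R : realType) (H : normedModType R[i]) (ip : {dot H for conjC}).
Hypothesis ipN : norm_from_inner ip.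
Implicit Types (x y z : H) (r : R).

(** The inner product of the underlying real space, symmetric and bilinear without conjugates.
    Nothing is lost: a vector orthogonal to all vectors in this sense is orthogonal to itself, hence
    zero. *)
Definition rdot x y : R := complex.Re (ip x y).

Lemma rdotC x y : rdot x y = rdot y x.
Proof.
rewrite /rdot hermC expr0 mul1r /=.
by case: (ip y x).
Qed.

Lemma rdotDl x y z : rdot (x + y) z = rdot x z + rdot y z.
Proof. by rewrite /rdot linearDl raddfD. Qed.

Lemma rdotNl x z : rdot (- x) z = - rdot x z.
Proof. by rewrite /rdot linearNl raddfN. Qed.

Lemma rdotBl x y z : rdot (x - y) z = rdot x z - rdot y z.
Proof. by rewrite rdotDl rdotNl. Qed.

Lemma rdotZl r x z : rdot (r *:: x) z = r * rdot x z.
Proof.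
rewrite /rdot linearZl_LR /=; case: (ip x z) => a b /=.
by rewrite mul0r subr0.
Qed.

Lemma rdotDr x y z : rdot x (y + z) = rdot x y + rdot x z.
Proof. by rewrite rdotC rdotDl !(rdotC x). Qed.

Lemma rdotNr x z : rdot x (- z) = - rdot x z.
Proof. by rewrite rdotC rdotNl (rdotC x). Qed.

Lemma rdotBr x y z : rdot x (y - z) = rdot x y - rdot x z.
Proof. by rewrite rdotDr rdotNr. Qed.

Lemma rdotZr r x z : rdot x (r *:: z) = r * rdot x z.
Proof. by rewrite rdotC rdotZl (rdotC x). Qed.

Lemma rdotxx x : rdot x x = rnorm x ^+ 2.
Proof. by rewrite /rdot -ipN normE -rmorphXn. Qed.

Lemma rdot_CS x y : `|rdot x y| <= rnorm x * rnorm y.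
Proof.
have [y0|y0] := eqVneq (rnorm y) 0.
  rewrite (rnorm_eq0 y0) rnorm0 mulr0.
  by rewrite -(scale0r (0 : H)) -(rmorph0 (real_complex R)) rdotZr mul0r normr0.
have yp : 0 < rnorm y by rewrite lt_neqAle eq_sym y0 rnorm_ge0.
rewrite -ler_sqr ?nnegrE ?mulr_ge0 ?rnorm_ge0// real_normK ?num_real//.
have := sqr_ge0 (rnorm ((rnorm y ^+ 2) *:: x - (rdot x y) *:: y)).
rewrite -(rdotxx (_ - _)) !(rdotBl, rdotBr, rdotZl, rdotZr) (rdotC y x) !rdotxx.
set a := rnorm x; set b := rnorm y; set c := rdot x y.
have b2 : 0 < b ^+ 2 by rewrite exprn_gt0.
move=> h; rewrite -(ler_pM2l b2) -subr_ge0; move: h; congr (0 <= _); ring.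
Qed.

Lemma rdot_le x y : rdot x y <= rnorm x * rnorm y.
Proof. exact: le_trans (ler_norm _) (rdot_CS x y). Qed.

Lemma rdot_eq0 x : (forall y, rdot x y = 0) -> x = 0.
Proof.
move=> /(_ x); rewrite rdotxx => /eqP; rewrite expf_eq0 /= => /eqP.
exact: rnorm_eq0.
Qed.

Lemma cvg_rdot (T : Type) (F : set_system T) (FF : Filter F)
    (f g : T -> H) x y :
  rnorm (f t - x) @[t --> F] --> (0 : R) ->
  rnorm (g t - y) @[t --> F] --> (0 : R) ->
  rdot (f t) (g t) @[t --> F] --> rdot x y.
Proof.
move=> fx gy.
apply: (@cvg_dist_le _ _ _ _ _
   (fun t => rnorm (f t - x) * rnorm (g t - y) + rnorm (f t - x) * rnorm y
     + rnorm x * rnorm (g t - y))).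
- apply: nearW => t.
  have -> : rdot (f t) (g t) - rdot x y = rdot (f t - x) (g t - y)
     + rdot (f t - x) y + rdot x (g t - y).
    by rewrite !(rdotBl, rdotBr); ring.
  rewrite (le_trans (ler_normD _ _))// lerD ?rdot_CS//.
  by rewrite (le_trans (ler_normD _ _))// lerD ?rdot_CS.
- rewrite -[X in _ --> X]addr0 -[X in _ --> X + _]addr0.
  apply: cvgD; first apply: cvgD.
  + by rewrite -[X in _ --> X](mulr0 0); exact: cvgM.
  + by rewrite -(mul0r (rnorm y)); apply: cvgM => //; exact: cvg_cst.
  + by rewrite -(mulr0 (rnorm x)); apply: cvgM => //; exact: cvg_cst.
Qed.

End RealInner.

(** A bound by [g m + g n] is what a comparison of [u m] and [u n] through a common reference point
    yields, and also what the parallelogram law yields for a minimising sequence. *)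
Lemma rnorm_complete_dominated (R : realType) (V : completeNormedModType R[i])
    (u : nat -> V) (g : nat -> R) :
  (forall m n, rnorm (u m - u n) <= g m + g n) -> g @ \oo --> (0 : R) ->
  exists x, rnorm (u n - x) @[n --> \oo] --> (0 : R).
Proof.
move=> ug /cvgrPdist_lt g0; apply: rnorm_complete => e e0.
have [n0 _ gn] := g0 (e / 2) (divr_gt0 e0 (ltr0Sn _ 1)).
exists n0 => m n mn nn; rewrite (le_lt_trans (ug m n))//.
have := gn m mn; have := gn n nn; rewrite /= !sub0r !normrN => h1 h2.
have := ler_norm (g m); have := ler_norm (g n); lra.
Qed.

(** * Riesz representation and the Lax-Milgram lemma *)

Section Riesz.
Variables (R : realType) (H : completeNormedModType R[i]).
Variables (ip : {dot H for conjC}).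
Hypothesis ipN : norm_from_inner ip.
Local Notation rdot := (rdot ip).

Definition real_functional (F : H -> R) :=
  forall r x y, F (r *:: x + y) = r * F x + F y.

Definition real_subspace (W : set H) :=
  W 0 /\ forall r x y, W x -> W y -> W (r *:: x + y).

(* Minimise [|x|^2 - 2 F x] over [W]. *)
Lemma riesz_subspace (W : set H) (F : H -> R) (C : R) :
  real_subspace W -> real_functional F ->
  (forall x, `|F x| <= C * rnorm x) ->
  exists x : nat -> H, exists w : H,
    [/\ forall n, W (x n), rnorm (x n - w) @[n --> \oo] --> (0 : R)
     & forall v, W v -> rdot w v = F v].
Proof.
move=> [W0 Wlin] Flin FC.
pose J (x : H) := rnorm x ^+ 2 - 2 * F x.
have JE x : J x = rdot x x - 2 * F x by rewrite rdotxx.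
(* The lower bound is that of |x|^2 - 2 C |x| = (|x| - C)^2 - C^2. *)
have Jlb x : - C ^+ 2 <= J x.
  have := FC x; rewrite ler_norml /J => /andP[_ h].
  have := sqr_ge0 (rnorm x - C); nra.
pose E := [set J x | x in W].
have Einf : has_inf E.
  by split; [exists (J 0), 0|exists (- C ^+ 2) => _ [x _ <-]].
pose m := inf E.
have mJ x : W x -> m <= J x.
  by move=> Wx; apply: ge_inf; [exact: Einf.2|exists x].
(* The defect is a square because the parallelogram law bounds |x k - x n|^2 by twice the sum of the
   two defects. *)
have /choice[x xP] (n : nat) : exists x, W x /\ J x < m + (harmonic n) ^+ 2.
  have [|_ [x Wx <-] h] := @inf_adherent _ E ((harmonic n : R) ^+ 2) _ Einf.
    by rewrite exprn_gt0 ?invr_gt0.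
  by exists x.
have e0 n : 0 < (harmonic n : R) by rewrite invr_gt0.
have [w xw] : exists w, rnorm (x n - w) @[n --> \oo] --> (0 : R).
  apply: (@rnorm_complete_dominated _ _ _ (fun n => 2 * harmonic n)).
  - move=> k n; have [Wk xk] := xP k; have [Wn xn] := xP n.
    have Wm : W (2^-1 *:: (1 *:: x k + x n)).
      by rewrite -[X in W X]addr0; do 2?apply: (Wlin).
    have := mJ _ Wm.
    have F0 : F 0 = 0.
      by have := Flin 1 0 0; rewrite rscale1 addr0 => h; lra.
    have FZ r z : F (r *:: z) = r * F z by rewrite -[X in F X]addr0 Flin F0 addr0.
    rewrite JE rdotZl rdotZr FZ Flin rscale1 !(rdotDl, rdotDr) (rdotC ip (x n)).
    move: xk xn; rewrite !JE => xk xn mm.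
    rewrite -ler_sqr ?nnegrE ?rnorm_ge0 ?addr_ge0 ?mulr_ge0 ?(ltW (e0 _))//.
    rewrite -(rdotxx ipN) !(rdotBl, rdotBr) (rdotC ip (x n)).
    have := mulr_gt0 (e0 k) (e0 n).
    nra.
  - by rewrite -[X in _ --> X](mulr0 2); apply: cvgM;
      [exact: cvg_cst|exact: cvg_harmonic].
exists x, w; split => [n||v Wv]; [by have [] := xP n|exact: xw|].
have h1 : rdot (x n) v @[n --> \oo] --> rdot w v.
  apply: cvg_rdot => //.
  by under eq_fun do rewrite subrr rnorm0; exact: cvg_cst.
suff h2 : rdot (x n) v @[n --> \oo] --> F v.
  by rewrite -(cvg_lim _ h1) // -(cvg_lim _ h2).
(* Moving [x n] by [- g / q] along [v] would minimise [J] on that line if [q] were |v|^2. The added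
   1 keeps [q] invertible when v = 0, and q >= 1 turns g^2 < q e^2 into |g| <= q e. *)
pose q := rnorm v ^+ 2 + 1.
have q1 : 1 <= q by rewrite /q lerDr sqr_ge0.
apply: (@cvg_dist_le _ _ _ _ _ (fun n => q * harmonic n)); last first.
  by rewrite -[X in _ --> X](mulr0 q); apply: cvgM;
    [exact: cvg_cst|exact: cvg_harmonic].
apply: nearW => n; have [Wn xn] := xP n.
set g := _ - _.
have := mJ _ (Wlin (- g / q) _ _ Wv Wn); move: xn.
rewrite !JE Flin !(rdotDl, rdotDr) !(rdotZl, rdotZr) (rdotC ip v) (rdotxx ipN v).
have -> : rnorm v ^+ 2 = q - 1 by rewrite /q addrK.
have -> : rdot (x n) v = g + F v by rewrite /g subrK.
set e := harmonic n; set dd := rdot (x n) (x n).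
have q0 : 0 < q by lra.
have qr : q * q^-1 = 1 by rewrite divff// gt_eqF.
have p0 : 0 < q^-1 by rewrite invr_gt0.
set p := q^-1 in qr p0 *.
have -> : - g * p * (- g * p * (q - 1)) + - g * p * (g + F v) +
   (- g * p * (g + F v) + dd) - 2 * (- g * p * F v + F (x n)) =
   g ^+ 2 * p * (q * p) - g ^+ 2 * p * p - 2 * g ^+ 2 * p + dd - 2 * F (x n).
  by ring.
rewrite qr => xn h.
have g2p : g ^+ 2 * p < e ^+ 2.
  have := mulr_ge0 (mulr_ge0 (sqr_ge0 g) (ltW p0)) (ltW p0); lra.
rewrite -ler_sqr ?nnegrE ?mulr_ge0 ?(ltW (e0 _)) ?(ltW q0)//.
rewrite real_normK ?num_real//.
have -> : g ^+ 2 = q * (g ^+ 2 * p) by rewrite mulrCA qr mulr1.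
have -> : (q * e) ^+ 2 = q * (q * e ^+ 2) by ring.
rewrite ler_pM2l//.
have := sqr_ge0 e; nra.
Qed.

(** Riesz gives [T] with <T u, v> = B u v and [f] representing [F]. Coercivity bounds [T] from
    below, so the projection [l] of [f] onto the closure of the range of [T] is itself a value of
    [T]; the residual f - l is orthogonal to the range, in particular to its own image, and
    coercivity annihilates it. *)
Lemma lax_milgram_real (B : H -> H -> R) (C3 C4 : R) (F : H -> R) (C : R) :
  (forall u, real_functional (B u)) -> (forall v, real_functional (B^~ v)) ->
  (forall u v, `|B u v| <= C3 * rnorm u * rnorm v) ->
  0 < C4 -> (forall v, C4 * rnorm v ^+ 2 <= B v v) ->
  real_functional F -> (forall v, `|F v| <= C * rnorm v) ->
  exists u, forall v, B u v = F v.
Proof.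
move=> Br Bl BC C40 Bell Flin FC.
have full : real_subspace [set: H] by [].
have /choice[T TP] u : exists w, forall v, rdot w v = B u v.
  have [x [w [_ _ wP]]] := riesz_subspace full (Br u) (BC u).
  by exists w => v; exact: wP.
have [_ [f [_ _ fP]]] := riesz_subspace full Flin FC.
have rdotI x y : (forall v, rdot x v = rdot y v) -> x = y.
  move=> xy; apply/eqP; rewrite -subr_eq0; apply/eqP/(rdot_eq0 ipN) => v.
  by rewrite rdotBl xy subrr.
have TD r u v : T (r *:: u + v) = r *:: T u + T v.
  by apply: rdotI => z; rewrite rdotDl rdotZl !TP Bl.
have T0 : T 0 = 0.
  have := TD 1 0 0; rewrite !rscale1 addr0 => h.
  by apply: (addrI (T 0)); rewrite addr0.
have TB u v : T (u - v) = T u - T v.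
  by rewrite addrC -[- v](scaleN1r v) -(rmorphN1 (real_complex R)) TD
    rmorphN1 scaleN1r addrC.
have Tge u : C4 * rnorm u <= rnorm (T u).
  have [u0|u0] := eqVneq (rnorm u) 0; first by rewrite u0 mulr0 rnorm_ge0.
  have up : 0 < rnorm u by rewrite lt_neqAle eq_sym u0 rnorm_ge0.
  rewrite -(ler_pM2r up) -mulrA -expr2 (le_trans (Bell u))// -TP.
  exact: rdot_le.
have sT : real_subspace (range T).
  split; first by exists 0.
  by move=> r _ _ [u _ <-] [v _ <-]; exists (r *:: u + v).
have flin : real_functional (rdot f) by move=> r u v; rewrite rdotDr rdotZr.
have [w [l [wT wl lP]]] := riesz_subspace sT flin (rdot_CS ipN f).
have /choice[u uP] n : exists u, T u = w n by have [u _] := wT n; exists u.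
have wl' : rnorm (w n - l) / C4 @[n --> \oo] --> (0 : R).
  by rewrite -(mul0r (C4^-1)); apply: cvgM => //; exact: cvg_cst.
have [z uz] : exists z, rnorm (u n - z) @[n --> \oo] --> (0 : R).
  apply: (rnorm_complete_dominated _ wl') => m n.
  rewrite -mulrDl ler_pdivlMr// mulrC (le_trans (Tge _))// TB !uP.
  by rewrite (le_trans (rnorm_triangle l _ _))// (rnormB l).
have Tz : T z = l.
  apply: rdotI => v.
  have h1 : rdot (w n) v @[n --> \oo] --> rdot l v.
    apply: cvg_rdot => //.
    by under eq_fun do rewrite subrr rnorm0; exact: cvg_cst.
  have h2 : rdot (w n) v @[n --> \oo] --> rdot (T z) v.
    apply: (@cvg_dist_le _ _ _ _ _ (fun n => C3 * rnorm (u n - z) * rnorm v)).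
      by apply: nearW => n; rewrite -uP -rdotBl -TB TP.
    rewrite -(mul0r (rnorm v)); apply: cvgM; last exact: cvg_cst.
    by rewrite -[X in _ --> X](mulr0 C3); apply: cvgM => //; exact: cvg_cst.
  by rewrite -(cvg_lim _ h1) // -(cvg_lim _ h2).
exists z => v; rewrite -TP Tz -fP//.
have := lP (T (f - l)) (ex_intro2 _ _ (f - l) I erefl).
move=> /eqP; rewrite -subr_eq0 -rdotBl -opprB rdotNl oppr_eq0 rdotC TP => /eqP h.
have := Bell (f - l); rewrite h pmulr_rle0// => h0.
have : rnorm (f - l) = 0.
  by apply/eqP; rewrite -sqrf_eq0 eq_le h0 sqr_ge0.
by move=> /rnorm_eq0/eqP; rewrite subr_eq0 => /eqP ->.
Qed.

End Riesz.

Lemma continuous_rnorm_bounded (R : realType) (V W : normedModType R[i])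
    (f : {linear V -> W}) : continuous f ->
  exists2 C : R, 0 < C & forall x, rnorm (f x) <= C * rnorm x.
Proof.
move=> /(_ 0); rewrite /continuous_at linear0 => f0.
have [e e0 fe] := nbhs_rnorm (f0 _ (rnorm_ball (0 : W) (@ltr01 R))).
exists (2 / e) => [|x]; first by rewrite divr_gt0.
have [x0|x0] := eqVneq (rnorm x) 0.
  by rewrite (rnorm_eq0 x0) linear0 !rnorm0 mulr0.
have xp : 0 < rnorm x by rewrite lt_neqAle eq_sym x0 rnorm_ge0.
have := fe ((e / 2 / rnorm x) *:: x).
rewrite subr0 /= subr0 linearZ /= !rnormZ gtr0_norm ?divr_gt0//.
rewrite divfK// => /(_ _) /ltW h.
rewrite -(ler_pM2l (_ : 0 < e / 2 / rnorm x)) ?divr_gt0//.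
have -> : e / 2 / rnorm x * (2 / e * rnorm x) = 1.
  by field; rewrite x0 gt_eqF.
by apply: h; rewrite ltr_pdivrMr// ltr_pMr// ltr1n.
Qed.

(** * Uniform boundedness *)

Section UniformBoundedness.
Variables (R : realType) (V : completeNormedModType R[i]) (W : normedModType R[i]).
Variable T : nat -> {linear V -> W}.

(* Otherwise a nested sequence of balls on which [T (n k)] exceeds [k]
   contradicts pointwise boundedness at the common point. *)
Lemma uniform_boundedness :
  (forall n, continuous (T n)) ->
  (forall x, exists C : R, forall n, rnorm (T n x) <= C) ->
  exists C : R, forall n x, rnorm (T n x) <= C * rnorm x.
Proof.
move=> Tcont Tpw; apply: contrapT => Tunb.
have big (x : V) (r K : R) : 0 < r ->
    exists n y, rnorm (y - x) < r /\ K < rnorm (T n y).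
  move=> r0; apply: contrapT => small; apply: Tunb.
  have le n y : rnorm (y - x) < r -> rnorm (T n y) <= K.
    by move=> yx; rewrite leNgt; apply/negP => Ky; apply: small; exists n, y.
  (* A multiple of [z] of length r / 2 is the difference of two points of the ball, so its image has
     norm at most 2 K. *)
  exists (4 * K / r) => n z.
  have [z0|z0] := eqVneq (rnorm z) 0.
    by rewrite (rnorm_eq0 z0) linear0 !rnorm0 mulr0.
  have zp : 0 < rnorm z by rewrite lt_neqAle eq_sym z0 rnorm_ge0.
  pose s := r / 2 / rnorm z.
  have s0 : 0 < s by rewrite !divr_gt0.
  have h1 : rnorm (T n x) <= K by apply: le; rewrite subrr rnorm0.
  have h2 : rnorm (T n (x + s *:: z)) <= K.
    apply: le; rewrite addrC addKr rnormZ gtr0_norm// /s divfK//.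
    by rewrite ltr_pdivrMr// ltr_pMr// ltr1n.
  rewrite -(ler_pM2l s0) -[X in X * _ <= _](gtr0_norm s0) -rnormZ.
  have -> : s * (4 * K / r * rnorm z) = K + K by rewrite /s; field; rewrite z0 gt_eqF.
  rewrite -linearZ /= -(addKr x (s *:: z)) linearD linearN.
  rewrite (le_trans (ler_rnormD _ _))// rnormN lerD//.
have step (k : nat) (p : V * R) : exists q : V * R * nat, 0 < p.2 ->
    [/\ 0 < q.1.2, q.1.2 <= harmonic k, rnorm (q.1.1 - p.1) + q.1.2 <= p.2
      & forall y, rnorm (y - q.1.1) <= q.1.2 -> k%:R < rnorm (T q.2 y)].
  (* For a nonpositive radius the value is arbitrary: it only makes the choice function total. *)
  have [p0|p0] := ltP 0 p.2; last by exists (p, 0%N).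
  have [n [y [yp Ty]]] := big p.1 p.2 k%:R p0.
  have [C C0 TC] := continuous_rnorm_bounded (Tcont n).
  pose d := rnorm (T n y) - k%:R.
  have d0 : 0 < d by rewrite subr_gt0.
  have h0 : 0 < harmonic k :> R by rewrite invr_gt0.
  (* The three bounds make the radii tend to 0, nest the closed balls, and let [T n] vary by at most
     d / 2 on the new ball, which keeps its norm above [k]. *)
  pose r := minr (harmonic k) (minr (p.2 - rnorm (y - p.1)) (d / (2 * C))).
  exists (y, r, n) => _; split => /=.
  - by rewrite !lt_min h0 subr_gt0 yp divr_gt0// mulr_gt0.
  - by rewrite ge_min lexx.
  - by rewrite -lerBrDl ge_min ge_min lexx orbT.
  - move=> z zr; have rd : rnorm (z - y) <= d / (2 * C).
      by rewrite (le_trans zr)// !ge_min lexx !orbT.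
    have : rnorm (T n y - T n z) <= d / 2.
      rewrite -linearB (le_trans (TC _))// rnormB -ler_pdivlMl//.
      by rewrite (le_trans rd)// invfM mulrA mulrC.
    have := rnorm_triangle (T n z) (T n y) 0; rewrite !subr0.
    move: d0; rewrite /d; lra.
have {}step k : exists f : V * R -> V * R * nat, forall p, 0 < p.2 ->
    [/\ 0 < (f p).1.2, (f p).1.2 <= harmonic k,
      rnorm ((f p).1.1 - p.1) + (f p).1.2 <= p.2
      & forall y, rnorm (y - (f p).1.1) <= (f p).1.2 -> k%:R < rnorm (T (f p).2 y)].
  by have /choice[f fP] := step k; exists f.
have /choice[f fP] := step.
pose p := fix p k := if k is j.+1 then (f j (p j)).1 else (0 : V, 1 : R).
have p0 k : 0 < (p k).2.
  by elim: k => [|k IH] //=; have [] := fP k _ IH.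
have pmono k j : rnorm ((p (k + j)%N).1 - (p k).1) + (p (k + j)%N).2 <= (p k).2.
  elim: j => [|j IH]; first by rewrite addn0 subrr rnorm0 add0r.
  rewrite addnS /=; have [_ _ h _] := fP (k + j)%N _ (p0 (k + j)%N).
  have := rnorm_triangle (p (k + j)%N).1 (f (k + j)%N (p (k + j)%N)).1.1 (p k).1.
  lra.
have pclose k j : (k <= j)%N -> rnorm ((p j).1 - (p k).1) <= (p k).2.
  by move=> /subnKC <-; rewrite (le_trans _ (pmono k (j - k)%N))// lerDl ltW.
have pharm k : (p k.+1).2 <= harmonic k by have [] := fP k _ (p0 k).
have [x px] : exists x, rnorm ((p n.+1).1 - x) @[n --> \oo] --> (0 : R).
  apply: (@rnorm_complete_dominated _ _ _ harmonic); last exact: cvg_harmonic.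
  move=> m n.
  have hm : 0 <= harmonic m :> R by rewrite invr_ge0.
  have hn : 0 <= harmonic n :> R by rewrite invr_ge0.
  have [mn|nm] := leqP m n.
    rewrite rnormB (le_trans (@pclose m.+1 n.+1 _))//.
    by rewrite (le_trans (pharm m))// lerDl.
  rewrite (le_trans (@pclose n.+1 m.+1 _))//; first exact: ltnW.
  by rewrite (le_trans (pharm n))// lerDr.
have xclose k : rnorm (x - (p k.+1).1) <= (p k.+1).2.
  apply/ler_addgt0Pr => e e0; move/cvgrPdist_lt: px => /(_ e e0)[n0 _ pn0].
  have := pn0 (maxn n0 k) (leq_maxl _ _); rewrite /= sub0r normrN.
  rewrite ger0_norm ?rnorm_ge0// rnormB => h.
  have := @pclose k.+1 (maxn n0 k).+1; rewrite ltnS leq_maxr => /(_ isT) h1.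
  have := rnorm_triangle (p (maxn n0 k).+1).1 x (p k.+1).1.
  by move=> /le_trans; apply; rewrite addrC lerD// ltW.
have [C TC] := Tpw x.
have [k Ck] : exists k : nat, C < k%:R.
  by exists (truncn `|C|).+1; rewrite (le_lt_trans (ler_norm C))// truncnS_gt.
have [_ _ _ h] := fP k _ (p0 k).
by have := TC (f k (p k)).2; rewrite leNgt (lt_trans Ck)// h//; exact: xclose.
Qed.

End UniformBoundedness.

(** * Calculus of one real variable *)

Section RealFunctions.
Variable R : realType.
Implicit Types (f df : R -> R) (t l : R).

Lemma is_derive_cvg f t l :
  h^-1 * (f (t + h) - f t) @[h --> 0^'] --> l -> is_derive t 1 f l.
Proof.
move=> fl; have fl' : (h^-1 *: (f (h *: (1 : R) + t) - f t)) @[h --> 0^'] --> l.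
  apply: cvg_trans fl; apply: near_eq_cvg; apply: nearW => h.
  by rewrite [h *: 1]mulr1 (addrC h).
by apply: DeriveDef; [apply/cvg_ex; exists l|exact: cvg_lim].
Qed.

(** Left increments of an orbit will be estimated by right increments of length [|h|], the only ones
    that strong continuity and the generator control. *)
Lemma cvg_abs f l : f @ 0^'+ --> l -> f `|h| @[h --> (0 : R)^'] --> l.
Proof.
move=> fl A lA; have [e /= e0 eA] := fl A lA; exists e => //= h.
rewrite /= !sub0r !normrN => he h0; apply: eA; last by rewrite normr_gt0.
by rewrite /= sub0r normrN normr_id.
Qed.

Lemma derive_le0_nonincreasing f df (s t : R) : s <= t ->
  (forall x : R, s <= x -> is_derive x 1 f (df x)) ->
  (forall x : R, s < x < t -> df x <= 0) -> f t <= f s.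
Proof.
move=> st fd df0.
apply: (@ler0_derive1_le_cc _ f s t) => //; rewrite ?in_itv/= ?lexx ?st//.
- move=> x; rewrite in_itv/= => /andP[sx _].
  by have [] := fd x (ltW sx).
- move=> x; rewrite in_itv/= => /andP[sx xt].
  rewrite derive1E; have [_ ->] := fd x (ltW sx).
  by apply: df0; rewrite sx.
- apply: derivable_within_continuous => x; rewrite in_itv/= => /andP[sx _].
  by have [] := fd x sx.
Qed.

Lemma is_derive_right_eq0 f t l : is_derive t 1 f l ->
  (forall s, t <= s -> f s = 0) -> l = 0.
Proof.
move=> [/cvg_ex[m fm] <-] f0; rewrite [LHS](cvg_lim _ fm)//.
apply: (cvg_unique _ (cvg_dnbhs_at_right fm)) => //.
have c0 : (fun=> 0 : R) x @[x --> (0 : R)^'+] --> (0 : R) by exact: cvg_cst.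
apply: cvg_trans c0; apply: near_eq_cvg; near=> h.
have h0 : 0 < h by [].
by rewrite /= [h *: 1]mulr1 !f0 ?subrr ?scaler0// lerDr ltW.
Unshelve. all: by end_near. Qed.

End RealFunctions.

(** * Orbits of a strongly continuous semigroup *)

Section Semigroup.
Variables (R : realType) (H : completeNormedModType R[i]).
Variables (ip : {dot H for conjC}).
Hypothesis ipN : norm_from_inner ip.
Variable S : R -> {linear H -> H}.
Hypothesis SC0 : C0_semigroup S.
Local Notation rdot := (rdot ip).

Lemma semigroup0 x : S 0 x = x.
Proof. by have [_ h _ _] := SC0. Qed.

Lemma semigroupD s t x : 0 <= s -> 0 <= t -> S (s + t) x = S s (S t x).
Proof. by have [_ _ h _] := SC0 => s0 t0; rewrite h. Qed.

Lemma semigroupC s t x : 0 <= s -> 0 <= t -> S s (S t x) = S t (S s x).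
Proof. by move=> s0 t0; rewrite -!semigroupD// addrC. Qed.

Lemma semigroup_cvg0 x : rnorm (S h x - x) @[h --> 0^'+] --> (0 : R).
Proof. by have [_ _ _ h] := SC0; apply/cvg_rnormP; exact: h. Qed.

(** Otherwise there are times t n -> 0 at which the operator norm exceeds n. Strong continuity at 0
    bounds every sequence S (t n) x, and uniform boundedness gives a contradiction. *)
Lemma semigroup_bounded_near0 : exists d C : R,
  0 < d /\ forall t x, 0 <= t -> t <= d -> rnorm (S t x) <= C * rnorm x.
Proof.
apply: contrapT => nb.
have /choice[t tP] (n : nat) : exists t, [/\ 0 <= t, t <= harmonic n &
    exists x, n%:R * rnorm x < rnorm (S t x)].
  apply: contrapT => nt; apply: nb; exists (harmonic n), n%:R.
  split=> [|t x t0 tn]; first by rewrite invr_gt0.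
  rewrite leNgt; apply/negP => h; apply: nt; exists t; split => //.
  by exists x.
have [||C TC] := @uniform_boundedness R H H (fun n => S (t n)).
- by move=> n; have [h _ _ _] := SC0; have [t0 _ _] := tP n; exact: h.
- move=> x; have tx : rnorm (S (t n) x - x) @[n --> \oo] --> (0 : R).
    apply/cvgrPdist_lt => e e0.
    have /cvgrPdist_lt/(_ e e0)[d /= d0 dP] := semigroup_cvg0 x.
    have /cvgrPdist_lt/(_ d d0)[n0 _ n0P] := @cvg_harmonic R.
    exists n0 => // n /= n0n; have [tn0 tnh _] := tP n.
    rewrite sub0r normrN ger0_norm ?rnorm_ge0//.
    (* The right limit at 0 says nothing about the time 0 itself. *)
    have [->|tn] := eqVneq (t n) 0; first by rewrite semigroup0 subrr rnorm0.
    have := dP (t n); rewrite /= !sub0r !normrN (ger0_norm tn0) => /(_ _ _).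
    rewrite ger0_norm ?rnorm_ge0//; apply; last by rewrite lt_neqAle eq_sym tn.
    rewrite (le_lt_trans tnh)//; have := n0P n n0n.
    by rewrite /= sub0r normrN ger0_norm ?invr_ge0.
  have /cvg_seq_bounded/pinfty_ex_gt0[M _ MP] :
    cvg (rnorm (S (t n) x - x) @[n --> \oo]) by apply/cvg_ex; exists 0.
  exists (M + rnorm x) => n; have := MP n I.
  rewrite /= ger0_norm ?rnorm_ge0// => h.
  by rewrite -{1}(subrK x (S (t n) x)) (le_trans (ler_rnormD _ _))// lerD2r.
- have [_ _ [x]] := tP (truncn `|C|).+1.
  apply/negP; rewrite -leNgt (le_trans (TC _ x))// ler_wpM2r ?rnorm_ge0//.
  by rewrite (le_trans (ler_norm C))// ltW// truncnS_gt.
Qed.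

Lemma semigroup_bounded (T : R) : exists C : R, 1 <= C /\
  forall t x, 0 <= t -> t <= T -> rnorm (S t x) <= C * rnorm x.
Proof.
have [d [C' [d0 SC']]] := semigroup_bounded_near0.
(* At least 1, so that the powers of [C] increase with the number of steps of length [d]. *)
pose C := maxr 1 C'.
have C1 : 1 <= C by rewrite le_max lexx.
have C0 : 0 <= C by exact: le_trans ler01 C1.
have SC t x : 0 <= t -> t <= d -> rnorm (S t x) <= C * rnorm x.
  move=> t0 td; rewrite (le_trans (SC' _ _ t0 td))// ler_wpM2r ?rnorm_ge0//.
  by rewrite le_max lexx orbT.
have SCn (n : nat) t x : 0 <= t -> t <= n%:R * d -> rnorm (S t x) <= C ^+ n * rnorm x.
  elim: n t => [|n IH] t t0 tn.
    have -> : t = 0 by apply/eqP; rewrite eq_le t0 andbT -(mul0r d).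
    by rewrite semigroup0 mul1r.
  have [td|dt] := leP t d.
    rewrite (le_trans (SC _ _ t0 td))// ler_wpM2r ?rnorm_ge0//.
    by rewrite exprS ler_peMr// exprn_ege1.
  have td0 : 0 <= t - d by rewrite subr_ge0 ltW.
  rewrite -(subrK d t) addrC semigroupD//; last exact: ltW.
  rewrite (le_trans (SC _ _ (ltW d0) (lexx d)))// exprS -mulrA ler_wpM2l//.
  by apply: IH => //; rewrite lerBlDr -[X in _ + X]mul1r -mulrDl natr1.
exists (C ^+ (truncn (T / d)).+1); split; first exact: exprn_ege1.
move=> t x t0 tT; apply: SCn => //; rewrite (le_trans tT)//.
by rewrite -ler_pdivrMr// ltW// truncnS_gt.
Qed.

(** For h < 0 the factorisation S t = S (t + h) S (- h) reduces left continuity to continuity at 0,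
    at the price of a bound on S (t + h) that is uniform in h. *)
Lemma orbit_cvg t x : 0 < t ->
  rnorm (S (t + h) x - S t x) @[h --> 0^'] --> (0 : R).
Proof.
move=> t0; have [C [C1 SC]] := semigroup_bounded t.
apply: (@cvg_dist_le _ _ _ _ _ (fun h => C * rnorm (S `|h| x - x))).
  near=> h; rewrite subr0 ger0_norm ?rnorm_ge0//.
  have ht : `|h| < t by near: h; exact: dnbhs0_lt.
  have [h0|h0] := leP 0 h.
    by rewrite semigroupD ?(ltW t0)// -linearB /= ger0_norm// SC// ltW.
  have ht' : 0 <= t + h by move: ht; rewrite ltr0_norm//; lra.
  have tE y : S t y = S (t + h) (S (- h) y).
    by rewrite -semigroupD ?addrK// oppr_ge0 ltW.
  by rewrite tE rnormB -linearB /= ltr0_norm// SC// gerDl ltW.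
rewrite -[X in _ --> X](mulr0 C); apply: cvgM; first exact: cvg_cst.
by apply: (@cvg_abs _ (fun h => rnorm (S h x - x))); exact: semigroup_cvg0.
Unshelve. all: by end_near. Qed.

Lemma generator_rnorm p z : generator S (p, z) ->
  rnorm (h^-1 *:: (S h p - p) - z) @[h --> 0^'+] --> (0 : R).
Proof.
move=> pz; apply/cvg_rnormP; apply: cvg_trans pz; apply: near_eq_cvg.
by apply: nearW => h; rewrite fmorphV.
Qed.

Lemma generator_commute t p z : 0 <= t ->
  generator S (p, z) -> generator S (S t p, S t z).
Proof.
move=> t0 /generator_rnorm pz; have [C [C1 SC]] := semigroup_bounded t.
have : rnorm (h^-1 *:: (S h (S t p) - S t p) - S t z) @[h --> 0^'+] --> (0 : R).
  apply: (@cvg_dist_le _ _ _ _ _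
    (fun h => C * rnorm (h^-1 *:: (S h p - p) - z))).
    near=> h; rewrite subr0 ger0_norm ?rnorm_ge0// semigroupC//.
    by rewrite -linearB -linearZ -linearB /= SC.
  by rewrite -[X in _ --> X](mulr0 C); apply: cvgM => //; exact: cvg_cst.
move=> /cvg_rnormP; apply: cvg_trans; apply: near_eq_cvg.
by apply: nearW => h /=; rewrite fmorphV.
Unshelve. all: by end_near. Qed.

(** For h < 0 the quotient is S (t + h) applied to the right quotient of length -h at 0, so its
    natural limit is S (t + h) z; the second error term replaces this by S t z. *)
Lemma orbit_derivative t p z : 0 < t -> generator S (p, z) ->
  rnorm (h^-1 *:: (S (t + h) p - S t p) - S t z) @[h --> 0^'] --> (0 : R).
Proof.
move=> t0 /generator_rnorm pz; have [C [C1 SC]] := semigroup_bounded t.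
have C0 : 0 <= C by exact: le_trans ler01 C1.
apply: (@cvg_dist_le _ _ _ _ _ (fun h =>
  C * rnorm (`|h|^-1 *:: (S `|h| p - p) - z) + C * rnorm (S `|h| z - z))).
  near=> h; rewrite subr0 ger0_norm ?rnorm_ge0//.
  have ht : `|h| < t by near: h; exact: dnbhs0_lt.
  have [h0|h0] := leP 0 h.
    rewrite ger0_norm// semigroupD ?(ltW t0)// -linearB -linearZ -linearB /=.
    by rewrite (le_trans (SC _ _ (ltW t0) (lexx t)))// lerDl mulr_ge0 ?rnorm_ge0.
  have ht' : 0 <= t + h by move: ht; rewrite ltr0_norm//; lra.
  have htt : t + h <= t by rewrite gerDl ltW.
  have h0' : 0 <= - h by rewrite oppr_ge0 ltW.
  rewrite ltr0_norm//.
  have tE y : S t y = S (t + h) (S (- h) y) by rewrite -semigroupD// addrK.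
  rewrite (le_trans (rnorm_triangle (S (t + h) z) _ _))//; apply: lerD.
    have -> : h^-1 *:: (S (t + h) p - S t p) - S (t + h) z =
        S (t + h) ((- h)^-1 *:: (S (- h) p - p) - z).
      rewrite tE [RHS]linearB [in RHS]linearZ [in RHS]linearB /=.
      rewrite invrN rmorphN scaleNr -scalerN.
      by rewrite opprB.
    exact: SC.
  by rewrite tE -linearB /= (le_trans (SC _ _ ht' htt))// rnormB.
rewrite -[X in _ --> X]addr0; apply: cvgD.
  rewrite -[X in _ --> X](mulr0 C); apply: cvgM; first exact: cvg_cst.
  exact: (@cvg_abs _ (fun h => rnorm (h^-1 *:: (S h p - p) - z))).
rewrite -[X in _ --> X](mulr0 C); apply: cvgM; first exact: cvg_cst.
by apply: (@cvg_abs _ (fun h => rnorm (S h z - z))); exact: semigroup_cvg0.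
Unshelve. all: by end_near. Qed.

Lemma is_derive_orbit_orbit (t : R) p z q w : 0 < t ->
  generator S (p, z) -> generator S (q, w) ->
  is_derive t 1 (fun s => rdot (S s p) (S s q))
    (rdot (S t z) (S t q) + rdot (S t p) (S t w)).
Proof.
move=> t0 pz qw; apply: is_derive_cvg.
have h1 : rdot (h^-1 *:: (S (t + h) p - S t p)) (S (t + h) q) @[h --> 0^']
    --> rdot (S t z) (S t q).
  apply: cvg_rdot => //; [exact: orbit_derivative|exact: orbit_cvg].
have h2 : rdot (S t p) (h^-1 *:: (S (t + h) q - S t q)) @[h --> 0^']
    --> rdot (S t p) (S t w).
  apply: cvg_rdot => //; last exact: orbit_derivative.
  by under eq_fun do rewrite subrr rnorm0; exact: cvg_cst.
apply: cvg_trans (cvgD h1 h2); apply: near_eq_cvg; apply: nearW => h /=.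
by rewrite fctE rdotZl rdotZr rdotBl rdotBr -mulrDr addrA subrK.
Qed.


End Semigroup.

(** * A factorial bound *)

Lemma leq_bin_expn n k : ('C(n, k) <= 2 ^ n)%N.
Proof.
elim: n k => [|n IH] [|k] //; first by rewrite bin0 expn_gt0.
by rewrite binS expnS mul2n -addnn leq_add.
Qed.

(** A substitute for Stirling's formula: each of the n factors of (2n)(2n - 1)...(n + 1) is at least
    n, and this product is binomial(2n, n) n!. *)
Lemma expnn_leq_fact n : (n ^ n <= 4 ^ n * n`!)%N.
Proof.
have -> : (4 ^ n = 2 ^ (n + n))%N by rewrite addnn -mul2n expnM.
rewrite (@leq_trans ((n + n) ^_ n)%N)//; last first.
  by rewrite -bin_ffact leq_mul2r leq_bin_expn orbT.
rewrite ffact_prod -[in leqLHS](card_ord n) -prod_nat_const card_ord.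
apply: leq_prod => i _; rewrite leq_subRL ?leq_addl//.
  by rewrite leq_add2r ltnW.
by rewrite (leq_trans (ltnW (ltn_ord i)))// leq_addr.
Qed.

(** * Unique continuation for smoothing semigroups *)

Section UniqueContinuation.
Variables (R : realType) (H : completeNormedModType R[i]).
Variables (ip : {dot H for conjC}).
Hypothesis ipN : norm_from_inner ip.
Variable S : R -> {linear H -> H}.
Hypothesis SC0 : C0_semigroup S.
Hypothesis Scontr : forall t x, 0 <= t -> rnorm (S t x) <= rnorm x.
Variable M : R.
Hypothesis M0 : 0 <= M.
Hypothesis Ssmooth : forall r z, 0 < r ->
  exists2 w, generator S (S r z, w) & rnorm w <= M / r * rnorm z.
Local Notation rdot := (rdot ip).

(** Although [z] need not lie in the domain of the generator, S r z does. The derivative is again a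
    scalar orbit, that of [w] delayed by [r], so differentiation can be iterated. *)
Lemma smoothed_orbit_derivative (r s : R) z w y : 0 < r -> r < s ->
  generator S (S r z, w) ->
  is_derive s 1 (fun s => rdot (S s z) y) (rdot (S (s - r) w) y).
Proof.
move=> r0 rs zw; apply: is_derive_cvg.
have sr0 : 0 < s - r by rewrite subr_gt0.
have h1 : rdot (h^-1 *:: (S (s - r + h) (S r z) - S (s - r) (S r z))) y @[h --> 0^']
    --> rdot (S (s - r) w) y.
  apply: (cvg_rdot ipN); first exact: orbit_derivative.
  by under eq_fun do rewrite subrr rnorm0; exact: cvg_cst.
apply: cvg_trans h1; apply: near_eq_cvg; near=> h.
have hs : `|h| < s - r by near: h; exact: dnbhs0_lt.
have hs0 : 0 <= s - r + h by move: hs; rewrite ltr_norml; lra.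
rewrite /= rdotZl rdotBl -!(semigroupD SC0) ?(ltW r0) ?(ltW sr0)//.
by rewrite subrK addrAC subrK.
Unshelve. all: by end_near. Qed.

Lemma smoothed_orbit_eq0 (r t0 : R) z w y : 0 < r -> r < t0 ->
  generator S (S r z, w) ->
  (forall s, t0 <= s -> rdot (S s z) y = 0) ->
  forall s, t0 - r <= s -> rdot (S s w) y = 0.
Proof.
move=> r0 rt0 zw z0 s ts.
have rs : r < s + r by rewrite ltrDr; lra.
have := smoothed_orbit_derivative y r0 rs zw; rewrite addrK.
by move/is_derive_right_eq0; apply=> x sx; apply: z0; lra.
Qed.

(** Each differentiation replaces [z] by [w], hence the general [z] and [t0] in the induction, and
    shifts both [s] and [t0] by [r]: the distance t0 - s is unchanged, while n delays must fit below
    [s]. *)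
Lemma orbit_taylor_bound n : forall (r t0 : R) z y, 0 < r ->
  (forall s, t0 <= s -> rdot (S s z) y = 0) ->
  forall s, n%:R * r < s -> s <= t0 ->
  `|rdot (S s z) y| <=
    (M / r) ^+ n * (rnorm z * rnorm y) * ((t0 - s) ^+ n / n`!%:R).
Proof.
elim: n => [|n IH] r t0 z y r0 z0 s ns st.
  rewrite !expr0 fact0 divr1 mul1r mulr1 (le_trans (rdot_CS ipN _ _))//.
  by rewrite ler_wpM2r ?rnorm_ge0// Scontr// ltW//; move: ns; rewrite mul0r.
have Mr : 0 <= M / r by rewrite divr_ge0// ltW.
have nr0 : 0 <= n%:R * r by rewrite mulr_ge0// ltW.
have rs : r < s by rewrite (le_lt_trans _ ns)// -natr1 mulrDl mul1r lerDr.
have [w zw wz] := Ssmooth z r0.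
have w0 := smoothed_orbit_eq0 r0 (lt_le_trans rs st) zw z0.
pose K := (M / r) ^+ n.+1 * (rnorm z * rnorm y).
pose g s := rdot (S s z) y.
(* The integral from [x] to [t0] of the bound on the derivative. As [b] and [g] vanish at [t0] and b
   + g, b - g are nonincreasing, |g| <= b follows without integrating. *)
pose b (x : R) := K * ((t0 - x) ^+ n.+1 / n.+1`!%:R).
pose db (x : R) := - (K * ((t0 - x) ^+ n / n`!%:R)).
have dbP (x : R) : is_derive x 1 b (db x).
  have -> : b = (K / n.+1`!%:R) *: (cst t0 - id) ^+ n.+1.
    by apply/funext => u; rewrite /b fctE mulrCA mulrC.
  apply: is_derive_eq; rewrite /db factS natrM sub0r /GRing.scale /= !fctE.
  have f0 : n`!%:R != 0 :> R by rewrite pnatr_eq0 -lt0n fact_gt0.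
  by field; rewrite f0 nat1r pnatr_eq0.
have dg (x : R) : s <= x -> is_derive x 1 g (rdot (S (x - r) w) y).
  by move=> sx; apply: smoothed_orbit_derivative => //; exact: lt_le_trans sx.
have dg_le (x : R) : s < x < t0 -> `|rdot (S (x - r) w) y| <= - db x.
  move=> /andP[sx xt].
  have := IH r (t0 - r) w y r0 w0 (x - r).
  have -> : t0 - r - (x - r) = t0 - x by ring.
  rewrite opprK => /(_ _ _)/le_trans; apply.
  - by rewrite ltrBrDr -[X in _ + X]mul1r -mulrDl natr1 (lt_trans ns).
  - by rewrite lerD2r ltW.
  - rewrite ler_wpM2r ?mulr_ge0 ?exprn_ge0 ?invr_ge0 ?subr_ge0 ?(ltW xt)//.
    rewrite /K exprSr -mulrA [X in _ <= _ * X]mulrA ler_wpM2l ?exprn_ge0//.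
    by rewrite ler_wpM2r ?rnorm_ge0.
have bt : b t0 = 0 by rewrite /b subrr expr0n mul0r mulr0.
have gt : g t0 = 0 by exact: z0.
rewrite -/(g s) -/K -/(b s) ler_norml; apply/andP; split.
- have := @derive_le0_nonincreasing _ (fun x => b x + g x)
    (fun x => db x + rdot (S (x - r) w) y) s t0 st.
  rewrite bt gt addr0 => /(_ _ _); rewrite -lerBlDl sub0r; apply.
    by move=> u su; have := dg u su => ?; exact: is_deriveD.
  move=> u /dg_le; rewrite ler_norml => /andP[]; lra.
- have := @derive_le0_nonincreasing _ (fun x => b x - g x)
    (fun x => db x - rdot (S (x - r) w) y) s t0 st.
  rewrite bt gt subr0 subr_ge0; apply.
    by move=> u su; have := dg u su => ?; exact: is_deriveB.
  move=> u /dg_le; rewrite ler_norml => /andP[]; lra.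
Qed.

Lemma orbit_eq0_step (t0 s : R) z y :
  (forall s, t0 <= s -> rdot (S s z) y = 0) ->
  0 < s -> s <= t0 -> 4 * M * (t0 - s) < s -> rdot (S s z) y = 0.
Proof.
move=> z0 s0 st Ms.
pose rho := 4 * M * (t0 - s) / s.
have rho0 : 0 <= rho by rewrite divr_ge0 ?mulr_ge0 ?subr_ge0// ltW.
have rho1 : rho < 1 by rewrite /rho ltr_pdivrMr// mul1r.
pose K := 4 * (rnorm z * rnorm y).
have bound n : `|rdot (S s z) y| <= K * rho ^+ n.
  (* Dividing by n + 1 rather than n makes n r < s strict and includes n = 0. *)
  pose r := s / n.+1%:R.
  have r0 : 0 < r by rewrite divr_gt0.
  have nr : n%:R * r < s.
    by rewrite /r mulrCA gtr_pMr// ltr_pdivrMr// mul1r ltr_nat.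
  rewrite (le_trans (orbit_taylor_bound r0 z0 nr st))//.
  have f0 : (0 : R) < n`!%:R by rewrite ltr0n fact_gt0.
  have -> : (M / r) ^+ n * (rnorm z * rnorm y) * ((t0 - s) ^+ n / n`!%:R) =
      (rnorm z * rnorm y) * (M * (t0 - s) / s) ^+ n * (n.+1%:R ^+ n / n`!%:R).
    rewrite /r invf_div !exprMn exprVn; ring.
  have -> : K * rho ^+ n =
      (rnorm z * rnorm y) * (M * (t0 - s) / s) ^+ n * (4 * 4 ^+ n).
    have -> : rho = 4 * (M * (t0 - s) / s) by rewrite /rho !mulrA.
    rewrite /K [(4 * _) ^+ n]exprMn; set c := (_ / s) ^+ n; ring.
  rewrite ler_wpM2l//.
    by rewrite !mulr_ge0 ?rnorm_ge0// exprn_ge0// divr_ge0 ?(ltW s0)// mulr_ge0 ?subr_ge0.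
  (* Multiplying by n + 1 turns the claim into (n + 1)^(n + 1) <= 4^(n + 1) (n + 1)!. *)
  rewrite ler_pdivrMr// -exprS -(ler_pM2l (ltr0Sn R n)) mulrCA -exprS.
  by rewrite -natrM -factS -!natrX -natrM ler_nat expnn_leq_fact.
have lim0 : K * rho ^+ n @[n --> \oo] --> (0 : R).
  rewrite -[X in _ --> X](mulr0 K); apply: cvgM; first exact: cvg_cst.
  by apply: cvg_expr; rewrite ger0_norm.
apply/eqP; rewrite -normr_eq0 eq_le normr_ge0 andbT.
by rewrite -(cvg_lim _ lim0)//; apply: limr_ge; [apply/cvg_ex; exists 0|exact: nearW].
Qed.

Lemma orbit_eq0_pos (t0 : R) z y : 0 < t0 ->
  (forall s, t0 <= s -> rdot (S s z) y = 0) ->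
  forall s, 0 < s -> rdot (S s z) y = 0.
Proof.
(* From a threshold [t], the previous step reaches q t as soon as 4 M (1 - q) < q. This [q]
   satisfies it and lies strictly between 0 and 1 even when M = 0. *)
move=> t00 z0; pose q := (4 * M + 1) / (4 * M + 2).
have d0 : 0 < 4 * M + 2 by have := M0; lra.
have q0 : 0 < q by rewrite divr_gt0//; have := M0; lra.
have q1 : q < 1 by rewrite /q ltr_pdivrMr//; lra.
have qM : 4 * M * (1 - q) < q.
  have -> : 1 - q = (4 * M + 2)^-1 by rewrite /q; field; rewrite gt_eqF.
  by rewrite /q ltr_pM2r ?invr_gt0//; lra.
have zk k s : q ^+ k * t0 <= s -> rdot (S s z) y = 0.
  elim: k s => [|k IH] s; first by rewrite mul1r; exact: z0.
  rewrite exprS -mulrA; set t := q ^+ k * t0 in IH *.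
  have t0' : 0 < t by rewrite mulr_gt0// exprn_gt0.
  move=> ts; have [/IH//|st] := leP t s.
  have s0 : 0 < s by rewrite (lt_le_trans _ ts)// mulr_gt0.
  apply: (@orbit_eq0_step t) => //; first exact: ltW.
  rewrite (lt_le_trans _ ts)// (@le_lt_trans _ _ (4 * M * (1 - q) * t))//; last first.
    by rewrite ltr_pM2r.
  rewrite -[leRHS]mulrA ler_wpM2l ?mulr_ge0//; lra.
move=> s s0.
have lim0 : q ^+ k * t0 @[k --> \oo] --> (0 : R).
  rewrite -[X in _ --> X](mul0r t0); apply: cvgM; last exact: cvg_cst.
  by apply: cvg_expr; rewrite gtr0_norm.
move/cvgrPdist_lt: lim0 => /(_ s s0)[k _ /(_ k (leqnn k))] /=.
rewrite sub0r normrN gtr0_norm ?mulr_gt0 ?exprn_gt0// => ks.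
by apply: (zk k); exact: ltW.
Qed.

Lemma orbit_eq0 (t0 : R) z y : 0 < t0 ->
  (forall s, t0 <= s -> rdot (S s z) y = 0) -> rdot z y = 0.
Proof.
move=> t00 z0.
have lim : rdot (S s z) y @[s --> 0^'+] --> rdot z y.
  apply: (cvg_rdot ipN); first exact: (semigroup_cvg0 SC0).
  by under eq_fun do rewrite subrr rnorm0; exact: cvg_cst.
apply: (cvg_unique _ lim) => //.
have c0 : (fun=> 0 : R) x @[x --> (0 : R)^'+] --> (0 : R) by exact: cvg_cst.
apply: cvg_trans c0; apply: near_eq_cvg; near=> s.
by rewrite (orbit_eq0_pos t00 z0).
Unshelve. all: by end_near. Qed.

Lemma smoothing_semigroup_injective (t : R) : 0 < t -> injective (S t).
Proof.
move=> t0 x y xy; apply/eqP; rewrite -subr_eq0; apply/eqP.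
apply: (rdot_eq0 ipN) => z; apply: (orbit_eq0 t0) => s ts.
have st : 0 <= s - t by rewrite subr_ge0.
rewrite -(subrK t s) (semigroupD SC0) ?(ltW t0)// linearB /= xy subrr linear0.
by rewrite -(subrr (0 : H)) rdotBl subrr.
Qed.

Lemma smoothing_semigroup_dense_range (t : R) : 0 < t -> dense (range (S t)).
Proof.
move=> t0; apply/dense_rnormP => x e e0.
have sub : real_subspace (range (S t)).
  split; first by exists 0 => //; rewrite linear0.
  move=> r _ _ [u _ <-] [v _ <-]; exists (r *:: u + v) => //.
  by rewrite linearD linearZ.
have lin : real_functional (rdot x) by move=> r u v; rewrite rdotDr rdotZr.
(* [w] is the projection of [x] onto the closure of the range, so x - w is orthogonal to S s y for
   every [y] and every s >= t. *)
have [u [w [uW uw wP]]] := riesz_subspace ipN sub lin (rdot_CS ipN x).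
have : x - w = 0.
  apply: (rdot_eq0 ipN) => y; rewrite rdotC; apply: (orbit_eq0 t0) => s ts.
  have st : 0 <= s - t by rewrite subr_ge0.
  rewrite rdotBr (rdotC _ _ w) wP ?(rdotC _ x) ?subrr//.
  by exists (S (s - t) y) => //; rewrite -(semigroupD SC0) ?(ltW t0)// addrC subrK.
move=> /eqP; rewrite subr_eq0 => /eqP ->.
move/cvgrPdist_lt: uw => /(_ e e0)[n _ /(_ n (leqnn n))] /=.
rewrite sub0r normrN ger0_norm ?rnorm_ge0// => un.
by exists (u n) => //; exact: uW.
Qed.

End UniqueContinuation.

(** * The operator associated with an elliptic form *)

Section FormOperator.
Variables (R : realType) (V H : completeNormedModType R[i]).
Variables (ipV : {dot V for conjC}) (ipH : {dot H for conjC}).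
Hypothesis ipVN : norm_from_inner ipV.
Hypothesis ipHN : norm_from_inner ipH.
Variable emb : {linear V -> H}.
Hypothesis embP : dense_embedding emb.
Variable a : {bilinear V -> V -> R[i] | *%R & conjC \; *%R}.
Variables C3 C4 : R.
Hypothesis a_bounded : forall u v, `|a u v| <= C3%:C * `|u| * `|v|.
Hypothesis C4_gt0 : 0 < C4.
Hypothesis a_elliptic : forall v, C4%:C * `|v| ^+ 2 <= 'Re (a v v).
Local Notation rdot := (rdot ipH).
Local Notation A := (lax_milgram ipH emb a).

Definition rform u v : R := complex.Re (a u v).

Lemma rform_lin_l v : real_functional (rform^~ v).
Proof.
move=> r x y; rewrite /rform linearDl linearZl_LR raddfD /=.
by case: (a x v) => p q /=; rewrite mul0r subr0.
Qed.

Lemma rform_lin_r u : real_functional (rform u).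
Proof.
move=> r x y; rewrite /rform linearDr linearZr_LR raddfD /=.
by case: (a u x) => p q /=; rewrite oppr0 mul0r subr0.
Qed.

Lemma rform_bounded u v : `|rform u v| <= C3 * rnorm u * rnorm v.
Proof.
rewrite -lecR (le_trans (normc_ge_Re _))// (le_trans (a_bounded u v))//.
by rewrite !normE !rmorphM.
Qed.

Lemma rform_elliptic v : C4 * rnorm v ^+ 2 <= rform v v.
Proof.
by rewrite -lecR rmorphM rmorphXn /= -normE (le_trans (a_elliptic v))// -complexRe.
Qed.

(** Testing the real identity with i v as well as v recovers the imaginary part. *)
Lemma lax_milgram_rform x y :
  A (x, y) <-> exists2 u, emb u = x & forall v, rform u v = rdot y (emb v).
Proof.
split=> [[u /= ux uy]|[u ux uy]].
  exists u => // v; have := congr1 (fun f => complex.Re (f v)) uy.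
  by rewrite /form_operator /H_in_antidual.
exists u => //=; apply/funext => v; rewrite /form_operator /H_in_antidual.
have := uy v; have := uy ('i%C *: v).
rewrite /rform /rdot linearZ [emb _]linearZ /= linearZr_LR /=.
case: (a u v) (ipH y (emb v)) => p q [p' q'] /=.
rewrite !mul0r !sub0r !mulN1r !opprK => -> ->.
by [].
Qed.

Lemma lax_milgramB x y x' y' : A (x, y) -> A (x', y') -> A (x - x', y - y').
Proof.
move=> /lax_milgram_rform[u <- uy] /lax_milgram_rform[v <- vy].
apply/lax_milgram_rform; exists (u - v); first exact: linearB.
move=> w; rewrite rdotBl -uy -vy -[u - v]addrC -[- v]scaleN1r.
by rewrite -(rmorphN1 (real_complex R)) rform_lin_l mulN1r addrC.
Qed.

Lemma lax_milgramZ r x y : A (x, y) -> A (r *:: x, r *:: y).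
Proof.
move=> /lax_milgram_rform[u <- uy].
apply/lax_milgram_rform; exists (r *:: u); first exact: linearZ.
move=> w; rewrite rdotZl -uy -[_ *:: u]addr0 rform_lin_l.
by have := rform_lin_l w 1 0 0; rewrite rscale1 addr0; lra.
Qed.

(** The weak form of (I + e A) u = f, solved in [V]: the form e a alone already provides the
    coercivity. *)
Lemma resolvent_exists (e : R) (f : H) : 0 < e ->
  exists u, forall v, rdot (emb u) (emb v) + e * rform u v = rdot f (emb v).
Proof.
move=> e0; have [_ embC _] := embP.
have [C C0 embCP] := continuous_rnorm_bounded embC.
apply: (@lax_milgram_real _ _ _ ipVN
  (fun u v => rdot (emb u) (emb v) + e * rform u v)
  (C ^+ 2 + e * C3) (e * C4) _ (rnorm f * C)).
- move=> u r x y; rewrite linearD linearZ /= rdotDr rdotZr rform_lin_r; ring.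
- move=> u r x y; rewrite linearD linearZ /= rdotDl rdotZl rform_lin_l; ring.
- move=> u v; rewrite (le_trans (ler_normD _ _))// !mulrDl lerD//.
    rewrite (le_trans (rdot_CS ipHN _ _))// expr2 -mulrA mulrACA.
    by rewrite ler_pM ?rnorm_ge0.
  by rewrite normrM gtr0_norm// -!mulrA ler_wpM2l ?(ltW e0)// mulrA rform_bounded.
- by rewrite mulr_gt0.
- move=> v; rewrite -mulrA -[leLHS]add0r lerD//.
    by rewrite rdotxx// sqr_ge0.
  by rewrite ler_wpM2l ?(ltW e0)// rform_elliptic.
- by move=> r x y; rewrite linearD linearZ /= rdotDr rdotZr.
- move=> v; rewrite (le_trans (rdot_CS ipHN _ _))// -mulrA.
  by rewrite ler_wpM2l ?rnorm_ge0.
Qed.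

Lemma resolvent_domain (e : R) (f : H) u : 0 < e ->
  (forall v, rdot (emb u) (emb v) + e * rform u v = rdot f (emb v)) ->
  A (emb u, e^-1 *:: (f - emb u)).
Proof.
move=> e0 uf; apply/lax_milgram_rform; exists u => // v.
by rewrite rdotZl rdotBl -uf addrC addKr mulKf// gt_eqF.
Qed.

(** Testing with u - v0 bounds the left side by e (C3 m n - C4 n^2), where n = |u - v0| and m = |v0|
    in [V]; the constant is the maximum of this quadratic over n. *)
Lemma resolvent_approx (e : R) v0 u : 0 < e ->
  (forall v, rdot (emb u) (emb v) + e * rform u v = rdot (emb v0) (emb v)) ->
  rnorm (emb u - emb v0) ^+ 2 <= e * (C3 ^+ 2 / (4 * C4) * rnorm v0 ^+ 2).
Proof.
move=> e0 /(_ (u - v0)) h.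
have rB w : rform (u - v0) w = rform u w - rform v0 w.
  rewrite -[u - v0]addrC -[- v0]scaleN1r -(rmorphN1 (real_complex R)) rform_lin_l.
  by rewrite mulN1r addrC.
have h1 := rform_elliptic (u - v0); rewrite rB in h1.
have := rform_bounded v0 (u - v0); rewrite ler_norml => /andP[h2 _].
rewrite -(rdotxx ipHN) -linearB /= [X in rdot X]linearB rdotBl /=.
set n := rnorm (u - v0) in h1 h2; set m := rnorm v0 in h2 *.
rewrite -mulrA.
have -> : rdot (emb u) (emb (u - v0)) - rdot (emb v0) (emb (u - v0)) =
  - e * rform u (u - v0) by rewrite -h; ring.
rewrite mulNr -mulrN ler_pM2l//.
have : 0 <= (C3 / (2 * C4) * m - n) ^+ 2 by exact: sqr_ge0.
have -> : C3 ^+ 2 * ((4 * C4)^-1 * m ^+ 2) = C4 * (C3 / (2 * C4) * m) ^+ 2.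
  by field; rewrite gt_eqF.
have hc : C3 * m = 2 * C4 * (C3 / (2 * C4) * m) by field; rewrite gt_eqF.
rewrite hc in h2; set k := C3 / _ * m in h2 *.
rewrite sqrrB => h3.
have := mulr_ge0 (ltW C4_gt0) h3; nra.
Qed.

(** Approximate [x] by v0 in [V], then apply two resolvents: u2 solves (I + r2 A) u2 = u1 with u1 in
    D(A), so A u2 = (u1 - u2) / r2 is in D(A) too. The second order is needed to differentiate the
    square norm of the derivative of an orbit. *)
Lemma domain_sqr_dense x (d : R) : 0 < d ->
  exists p y z, [/\ A (p, y), A (y, z) & rnorm (p - x) < d].
Proof.
move=> d0; have [_ _ /dense_rnormP embD] := embP.
have approx v0 (e : R) : 0 < e -> exists u r, [/\ 0 < r,
    A (emb u, r^-1 *:: (emb v0 - emb u)) & rnorm (emb u - emb v0) < e].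
  move=> e0; pose K := C3 ^+ 2 / (4 * C4) * rnorm v0 ^+ 2.
  have K0 : 0 <= K.
    by rewrite mulr_ge0 ?sqr_ge0// divr_ge0 ?sqr_ge0// mulr_ge0// ltW.
  have K1 : 0 < K + 1 by rewrite ltr_wpDl.
  pose r := e ^+ 2 / (K + 1).
  have r0 : 0 < r by rewrite divr_gt0// exprn_gt0.
  have [u uP] := resolvent_exists (emb v0) r0.
  exists u, r; split => //; first exact: resolvent_domain.
  rewrite -ltr_sqr ?nnegrE ?rnorm_ge0 ?(ltW e0)//.
  rewrite (le_lt_trans (resolvent_approx r0 uP))// -/K /r.
  by rewrite -mulrA gtr_pMr ?exprn_gt0// mulrC ltr_pdivrMr// mul1r ltrDl.
have d3 : 0 < d / 3 by rewrite divr_gt0.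
have [_ [v0 _ <-] v0x] := embD x _ d3.
have [u1 [r1 [r10 Au1 u1v]]] := approx v0 _ d3.
have [u2 [r2 [r20 Au2 u2u]]] := approx u1 _ d3.
exists (emb u2), (r2^-1 *:: (emb u1 - emb u2)).
exists (r2^-1 *:: (r1^-1 *:: (emb v0 - emb u1) - r2^-1 *:: (emb u1 - emb u2))).
split => //; first by apply: lax_milgramZ; exact: lax_milgramB.
rewrite (le_lt_trans (rnorm_triangle (emb u1) _ _))//.
have := rnorm_triangle (emb v0) (emb u1) x; lra.
Qed.

(** Compare with the solution [u] of (I + A) u = l + m: monotonicity of A gives |x n - u| <= |x n -
    l| + |y n - m|, so the limit [l] is [u]. *)
Lemma lax_milgram_closed (x y : nat -> H) l m :
  (forall n, A (x n, y n)) ->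
  rnorm (x n - l) @[n --> \oo] --> (0 : R) ->
  rnorm (y n - m) @[n --> \oo] --> (0 : R) -> A (l, m).
Proof.
move=> Axy xl ym; have [u uP] := resolvent_exists (l + m) ltr01.
have xu : rnorm (x n - emb u) @[n --> \oo] --> (0 : R).
  apply: (@cvg_dist_le _ _ _ _ _ (fun n => rnorm (x n - l) + rnorm (y n - m))).
    apply: nearW => n; rewrite subr0 ger0_norm ?rnorm_ge0//.
    have /lax_milgram_rform[w <- wy] := Axy n.
    have h1 := uP (w - u); have h2 := wy (w - u).
    have [->|d0] := eqVneq (rnorm (emb w - emb u)) 0.
      by rewrite addr_ge0 ?rnorm_ge0.
    have dp : 0 < rnorm (emb w - emb u) by rewrite lt_neqAle eq_sym d0 rnorm_ge0.
    have rB : rform (w - u) (w - u) = rform w (w - u) - rform u (w - u).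
      rewrite -[w - u in X in rform X]addrC -[- u in X in rform X]scaleN1r.
      by rewrite -(rmorphN1 (real_complex R)) rform_lin_l mulN1r addrC.
    have h3 : 0 <= rform (w - u) (w - u).
      by rewrite (le_trans _ (rform_elliptic _))// mulr_ge0 ?sqr_ge0// ltW.
    rewrite -(ler_pM2r dp) -expr2 -(rdotxx ipHN).
    rewrite (@le_trans _ _ (rdot (emb w - l + (y n - m)) (emb (w - u))))//.
      move: h1 h2 h3; rewrite rB mul1r linearB /= !(rdotDl, rdotNl) => h1 h2 h3.
      lra.
    rewrite (le_trans (rdot_le ipHN _ _))// linearB /=.
    by rewrite ler_wpM2r ?rnorm_ge0// ler_rnormD.
  by rewrite -[X in _ --> X]addr0; exact: cvgD.
have lu : l = emb u.
  have h1 : x @ \oo --> l by apply/cvg_rnormP.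
  have h2 : x @ \oo --> emb u by apply/cvg_rnormP.
  by rewrite -(cvg_lim _ h1)// -(cvg_lim _ h2).
have := resolvent_domain ltr01 uP.
by rewrite -lu invr1 rscale1 addrC addKr.
Qed.

End FormOperator.

(** The left side is at most -2 c (M n - s m)^2. Here [al], [be], [ga] stand for a(u, u), a(u, q),
    a(q, q), with [n] and [m] the norms of u and q in [V]. *)
Lemma lyapunov_derivative_le0 (R : realDomainType) (c M s n m al be ga : R) :
  0 <= c -> 0 <= s -> c * n ^+ 2 <= al -> c * m ^+ 2 <= ga ->
  - (2 * c * M * n * m) <= be ->
  M ^+ 2 * (- al + - al) + (s ^+ 2 * (- ga + - ga) + - be * (2 * s)) <= 0.
Proof.
move=> c0 s0 h1 h2 h3.
have h4 := mulr_ge0 c0 (sqr_ge0 (M * n - s * m)).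
have h5 := ler_wpM2l (sqr_ge0 M) h1; have h6 := ler_wpM2l (sqr_ge0 s) h2.
have h7 := ler_wpM2l s0 h3; lra.
Qed.

(** * Contractivity and smoothing of the semigroup *)

Section FormSemigroup.
Variables (R : realType) (V H : completeNormedModType R[i]).
Variables (ipV : {dot V for conjC}) (ipH : {dot H for conjC}).
Hypothesis ipVN : norm_from_inner ipV.
Hypothesis ipHN : norm_from_inner ipH.
Variable emb : {linear V -> H}.
Hypothesis embP : dense_embedding emb.
Variable a : {bilinear V -> V -> R[i] | *%R & conjC \; *%R}.
Variables C3 C4 : R.
Hypothesis C3_gt0 : 0 < C3.
Hypothesis a_bounded : forall u v, `|a u v| <= C3%:C * `|u| * `|v|.
Hypothesis C4_gt0 : 0 < C4.
Hypothesis a_elliptic : forall v, C4%:C * `|v| ^+ 2 <= 'Re (a v v).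
Variable S : R -> {linear H -> H}.
Hypothesis SC0 : C0_semigroup S.
Local Notation rdot := (rdot ipH).
Local Notation A := (lax_milgram ipH emb a).
Hypothesis SA : generator S = op_opp A.
Local Notation rform := (rform a).

Let genA p z : generator S (p, z) <-> A (p, - z).
Proof. by rewrite SA. Qed.

Lemma generator_rform p z : generator S (p, z) ->
  exists2 u, emb u = p & forall v, rdot z (emb v) = - rform u v.
Proof.
move=> /genA/lax_milgram_rform[u up uz]; exists u => // v.
by rewrite uz rdotNl opprK.
Qed.

Lemma generator_dense x (d : R) : 0 < d -> exists p z w,
  [/\ generator S (p, z), generator S (z, w) & rnorm (p - x) < d].
Proof.
move=> d0.
have [p [y [w [py yw px]]]] :=
  domain_sqr_dense ipVN ipHN embP a_bounded C4_gt0 a_elliptic x d0.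
exists p, (- y), w; split => //; first by apply/genA; rewrite opprK.
apply/genA; have := lax_milgramZ (-1) yw.
by rewrite !rscaleN !rscale1.
Qed.

Lemma generatorB p z p' z' : generator S (p, z) -> generator S (p', z') ->
  generator S (p - p', z - z').
Proof.
by move=> /genA pz /genA pz'; apply/genA; have := lax_milgramB pz pz'; rewrite -opprD.
Qed.

Lemma generator_contraction p z t : 0 <= t -> generator S (p, z) ->
  rnorm (S t p) <= rnorm p.
Proof.
rewrite le_eqVlt => /predU1P[<-|t0] pz; first by rewrite (semigroup0 SC0).
rewrite -ler_sqr ?nnegrE ?rnorm_ge0// -!(rdotxx ipHN).
pose f s := rdot (S s p) (S s p).
have lim : f s @[s --> 0^'+] --> rdot p p.
  by apply: (cvg_rdot ipHN); exact: (semigroup_cvg0 SC0).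
(* Two-sided derivatives exist only at positive times, so the value at 0 enters as a right limit. *)
have le s : 0 < s -> s <= t -> f t <= f s.
  move=> s0 st; apply: (@derive_le0_nonincreasing _ f _ _ _ st).
    move=> x sx; apply: (is_derive_orbit_orbit ipHN SC0 _ pz pz).
    exact: lt_le_trans sx.
  move=> x /andP[sx _].
  have [u up uz] := generator_rform (generator_commute SC0 (ltW (lt_trans s0 sx)) pz).
  rewrite (rdotC _ (S x p)) -up uz.
  have := rform_elliptic a_elliptic u.
  have := mulr_ge0 (ltW C4_gt0) (sqr_ge0 (rnorm u)); lra.
rewrite -/(f t) -(cvg_lim _ lim)//; apply: limr_ge;
  first by apply/cvg_ex; eexists; exact: lim.
by near=> s; apply: le => //; near: s; exact: nbhs_right_le.
Unshelve. all: by end_near. Qed.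

Lemma form_semigroup_contraction t x : 0 <= t -> rnorm (S t x) <= rnorm x.
Proof.
move=> t0; have [C [C1 SC]] := semigroup_bounded SC0 t.
apply/ler_addgt0Pr => e e0.
(* Replacing [x] by [p] costs C |p - x| on the left and |p - x| on the right. *)
have [|p [z [_ [pz _ px]]]] := @generator_dense x (e / (C + 1)).
  by rewrite divr_gt0//; lra.
have h1 := SC t (x - p) t0 (lexx t).
have h2 := generator_contraction t0 pz.
have h3 : (C + 1) * rnorm (p - x) <= e.
  by rewrite -ler_pdivlMl; [rewrite mulrC ltW|lra].
rewrite linearB /= rnormB in h1.
have := ler_rnormD (S t x - S t p) (S t p); rewrite subrK.
have := ler_rnormD (p - x) x; rewrite subrK.
rewrite (rnormB (S t x)) (rnormB x) in h1 *; lra.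
Qed.

(* [M^2 |u|^2 + t^2 |u'|^2] is nonincreasing along an orbit [u]. *)
Lemma generator_smoothing p z w t : 0 < t ->
  generator S (p, z) -> generator S (z, w) ->
  rnorm (S t z) <= C3 / (2 * C4) / t * rnorm p.
Proof.
move=> t0 pz zw; set M := C3 / (2 * C4).
have M0 : 0 < M by rewrite divr_gt0// mulr_gt0.
pose f s := M ^+ 2 * rdot (S s p) (S s p) + s ^+ 2 * rdot (S s z) (S s z).
pose df s := M ^+ 2 * (rdot (S s z) (S s p) + rdot (S s p) (S s z)) +
  (s ^+ 2 * (rdot (S s w) (S s z) + rdot (S s z) (S s w)) +
   rdot (S s z) (S s z) * (2 * s)).
have fd (s : R) : 0 < s -> is_derive s 1 f (df s).
  move=> s0.
  have d1 := is_derive_orbit_orbit ipHN SC0 s0 pz pz.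
  have d2 := is_derive_orbit_orbit ipHN SC0 s0 zw zw.
  have -> : f = M ^+ 2 *: (fun s => rdot (S s p) (S s p)) +
     id ^+ 2 * (fun s => rdot (S s z) (S s z)).
    by apply/funext.
  apply: is_derive_eq; rewrite /df /GRing.scale /= !fctE.
  by rewrite expr1 mulr1.
have df0 (s : R) : 0 < s -> df s <= 0.
  move=> s0.
  have [u up uz] := generator_rform (generator_commute SC0 (ltW s0) pz).
  have [q qz qw] := generator_rform (generator_commute SC0 (ltW s0) zw).
  have e1 : rdot (S s z) (S s p) = - rform u u by rewrite -up uz.
  (* S s z is both the derivative of S s p and, as the image of q, an admissible test vector; so its
     square norm in [H] is a value of the form, bounded by C3 |u| |q|. *)
  have e2 : rdot (S s z) (S s z) = - rform u q by rewrite -{2}qz uz.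
  have e3 : rdot (S s w) (S s z) = - rform q q by rewrite -qz qw.
  rewrite /df (rdotC _ (S s p)) (rdotC _ (S s z) (S s w)) e1 e2 e3.
  apply: (lyapunov_derivative_le0 (ltW C4_gt0) (ltW s0)
    (rform_elliptic a_elliptic u) (rform_elliptic a_elliptic q)).
  have -> : 2 * C4 * M = C3 by rewrite /M; field; rewrite gt_eqF.
  by have := rform_bounded a_bounded u q; rewrite ler_norml => /andP[].
have le s : 0 < s -> s <= t -> f t <= f s.
  move=> s0 st; apply: (@derive_le0_nonincreasing _ f df _ _ st).
    by move=> x sx; apply: fd; exact: lt_le_trans sx.
  by move=> x /andP[sx _]; apply: df0; exact: lt_trans sx.
(* Contractivity replaces S s p and S s z by [p] and [z]; the term in [z] then disappears as s ->
   0. *)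
have le2 s : 0 < s -> s <= t -> (t * rnorm (S t z)) ^+ 2 <=
    (M * rnorm p) ^+ 2 + s ^+ 2 * rnorm z ^+ 2.
  move=> s0 st; have := le s s0 st; rewrite /f !(rdotxx ipHN) ![(_ * rnorm _) ^+ 2]exprMn => h.
  have hp := form_semigroup_contraction p (ltW s0).
  have hz := form_semigroup_contraction z (ltW s0).
  rewrite -ler_sqr ?nnegrE ?rnorm_ge0// in hp.
  rewrite -ler_sqr ?nnegrE ?rnorm_ge0// in hz.
  have := ler_wpM2l (sqr_ge0 M) hp; have := ler_wpM2l (sqr_ge0 s) hz.
  have := mulr_ge0 (sqr_ge0 M) (sqr_ge0 (rnorm (S t p))); lra.
have : (t * rnorm (S t z)) ^+ 2 <= (M * rnorm p) ^+ 2.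
  have lim : (M * rnorm p) ^+ 2 + s ^+ 2 * rnorm z ^+ 2 @[s --> 0^'+]
      --> (M * rnorm p) ^+ 2 + 0 ^+ 2 * rnorm z ^+ 2.
    apply: cvg_at_right_filter; apply: cvgD; first exact: cvg_cst.
    apply: cvgM; last exact: cvg_cst.
    by rewrite expr2; apply: cvgM; exact: cvg_id.
  have -> : (M * rnorm p) ^+ 2 = (M * rnorm p) ^+ 2 + 0 ^+ 2 * rnorm z ^+ 2.
    by rewrite expr0n mul0r addr0.
  rewrite -(cvg_lim _ lim)//; apply: limr_ge;
  first by apply/cvg_ex; eexists; exact: lim.
  by near=> s; apply: le2 => //; near: s; exact: nbhs_right_le.
have tz0 := mulr_ge0 (ltW t0) (rnorm_ge0 (S t z)).
rewrite ler_sqr ?nnegrE ?(mulr_ge0 (ltW M0) (rnorm_ge0 p))// => h.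
by rewrite mulrAC ler_pdivlMr// mulrC.
Unshelve. all: by end_near. Qed.

(** For p n in the domain of the square tending to [x], the images z n may diverge, but the
    smoothing estimate applied to differences makes S t (z n) a Cauchy sequence; closedness of A
    identifies its limit. *)
Lemma form_semigroup_smoothing t x : 0 < t ->
  exists2 y, generator S (S t x, y) & rnorm y <= C3 / (2 * C4) / t * rnorm x.
Proof.
move=> t0; set M := _ / t.
have M0 : 0 <= M.
  by apply: divr_ge0 (ltW t0); apply: divr_ge0; rewrite ?mulr_ge0// ltW.
have /choice[p /choice[z /choice[w pzw]]] (n : nat) : exists p z w,
    [/\ generator S (p, z), generator S (z, w) & rnorm (p - x) < harmonic n].
  by apply: generator_dense; rewrite invr_gt0.
have px : rnorm (p n - x) @[n --> \oo] --> (0 : R).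
  apply: (@cvg_dist_le _ _ _ _ _ harmonic); last exact: cvg_harmonic.
  apply: nearW => n; rewrite subr0 ger0_norm ?rnorm_ge0//.
  by have [_ _ /ltW] := pzw n.
have sm m n : rnorm (S t (z m) - S t (z n)) <= M * rnorm (p m - p n).
  have [pm zm _] := pzw m; have [pn zn _] := pzw n.
  have := generator_smoothing t0 (generatorB pm pn) (generatorB zm zn).
  by rewrite linearB.
have Mp : M * rnorm (p n - x) @[n --> \oo] --> (0 : R).
  by rewrite -[X in _ --> X](mulr0 M); apply: cvgM => //; exact: cvg_cst.
have [y zy] : exists y, rnorm (S t (z n) - y) @[n --> \oo] --> (0 : R).
  apply: (rnorm_complete_dominated _ Mp) => m n.
  rewrite (le_trans (sm m n))// -mulrDr ler_wpM2l//.
  by rewrite (le_trans (rnorm_triangle x _ _))// (rnormB x).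
exists y.
  apply/genA.
  apply: (lax_milgram_closed ipVN ipHN embP a_bounded C4_gt0 a_elliptic
    (x := fun n => S t (p n)) (y := fun n => - S t (z n))).
  - move=> n; have [pn _ _] := pzw n.
    by apply/genA; exact: generator_commute (ltW t0) pn.
  - apply: (@cvg_dist_le _ _ _ _ _ (fun n => rnorm (p n - x))) => //.
    apply: nearW => n; rewrite subr0 ger0_norm ?rnorm_ge0// -linearB.
    exact: form_semigroup_contraction (ltW t0).
  - apply: cvg_trans zy; apply: near_eq_cvg; apply: nearW => n.
    by rewrite -opprD rnormN.
have lim : M * rnorm x + (rnorm (S t (z n) - y) + M * rnorm (p n - x)) @[n --> \oo]
    --> M * rnorm x + (0 + 0).
  by apply: cvgD; [exact: cvg_cst|exact: cvgD].
rewrite -[leRHS]addr0 -[X in _ <= _ + X]addr0 -(cvg_lim _ lim)//.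
apply: limr_ge;
  first by apply/cvg_ex; eexists; exact: lim.
apply: nearW => n; have [pn zn _] := pzw n.
have h := generator_smoothing t0 pn zn; rewrite -/M in h.
have := rnorm_triangle (S t (z n)) y 0; rewrite !subr0 (rnormB y) => h2.
have := ler_rnormD (p n - x) x; rewrite subrK => /(ler_wpM2l M0).
rewrite mulrDr; lra.
Qed.

End FormSemigroup.

(** * The chain of domains *)

Lemma op_domain_inverse (R : realType) (H : normedModType R[i]) (f : H -> H) :
  op_domain (op_inverse (op_of_fun f)) = range f.
Proof.
by apply/seteqP; split => [x [y yx]|x [y _ yx]]; exists y.
Qed.

Theorem proposition10 (R : realType) (V H : completeNormedModType R[i])
    (ipV : {dot V for conjC}) (ipH : {dot H for conjC})
    (V_hilbert : norm_from_inner ipV) (H_hilbert : norm_from_inner ipH)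
    (V_separable : separable V) (H_separable : separable H)
    (emb : {linear V -> H}) (V_in_H : dense_embedding emb)
    (V_proper : range emb <> [set: H])
    (a : {bilinear V -> V -> R[i] | *%R & conjC \; *%R})
    (a_bounded : bounded_form a) (a_elliptic : elliptic_form a)
    (expA : R -> {linear H -> H})
    (expA_generated : generates (op_opp (lax_milgram ipH emb a)) expA)
    (spectrum_nonempty : spectrum (lax_milgram ipH emb a) !=set0) :
  (forall t t' : R, 0 < t -> t < t' ->
     op_domain (op_inverse (op_of_fun (expA t')))
       `<` op_domain (op_inverse (op_of_fun (expA t))) /\
     op_domain (op_inverse (op_of_fun (expA t))) `<` [set: H]) /\
  (forall t : R, 0 < t -> dense (op_domain (op_inverse (op_of_fun (expA t))))).

Proof.
have [C3 C30 aC3] := a_bounded; have [C4 C40 aC4] := a_elliptic.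
have [SC0 SA] := expA_generated.
pose M := C3 / (2 * C4).
have M0 : 0 <= M by rewrite divr_ge0 ?mulr_ge0// ltW.
have contr t x : 0 <= t -> rnorm (expA t x) <= rnorm x.
  by move=> t0; exact: (form_semigroup_contraction V_hilbert H_hilbert V_in_H
    aC3 C40 aC4 SC0 SA).
have smooth t x : 0 < t ->
    exists2 y, generator (expA) (expA t x, y) & rnorm y <= M / t * rnorm x.
  by move=> t0; exact: (form_semigroup_smoothing V_hilbert H_hilbert V_in_H
    C30 aC3 C40 aC4 SC0 SA).
have inj t : 0 < t -> injective (expA t).
  exact: (smoothing_semigroup_injective H_hilbert SC0 contr M0 smooth).
have notT t : 0 < t -> ~ ([set: H] `<=` range (expA t)).
  move=> t0 full; apply: V_proper; apply/seteqP; split => // x _.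
  have [y _ <-] := full x I; have [w + _] := smooth t y t0.
  by rewrite SA => -[u /= <- _]; exists u.
split => [t t' t0 tt'|t t0]; rewrite !op_domain_inverse; last first.
  exact: (smoothing_semigroup_dense_range H_hilbert SC0 contr M0 smooth).
have d0 : 0 < t' - t by rewrite subr_gt0.
have t'E x : expA t' x = expA t (expA (t' - t) x).
  by rewrite -(semigroupD SC0) ?(ltW t0) ?(ltW d0)// addrC subrK.
split; split => //; [|move=> tt|exact: notT].
  by move=> _ [x _ <-]; exists (expA (t' - t) x).
apply: (notT _ d0) => x _.
have [|y _] := tt (expA t x); first by exists x.
by rewrite t'E => /(inj t t0) yx; exists y.
Qed.
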